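(* Let $d,n\ge1$. Let $x^{(1)},\dots,x^{(n+1)}\in\mathbb{R}^d$ be i.i.d. $\mathcal{N}(0,I_d)$, let $w_\star\sim\mathcal{N}(0,I_d)$ be independent, and $y^{(i)}=\langle x^{(i)},w_\star\rangle$ for $i\le n$. Let $$Z_0=\begin{bmatrix} x^{(1)} & \cdots & x^{(n)} & x^{(n+1)}\\ y^{(1)} & \cdots & y^{(n)} & 0\end{bmatrix},\qquad M=\begin{bmatrix} I_n & 0\\ 0& 0\end{bmatrix}\in\mathbb{R}^{(n+1)\times(n+1)}.$$ For symmetric $A_0,A_1\in\mathbb{R}^{d\times d}$, let $P_i=\begin{bmatrix}0_{d\times d}&0\\0&1\end{bmatrix}$, $Q_i=\begin{bmatrix}A_i&0\\0&0\end{bmatrix}$, $Z_{i+1}=Z_i+\frac1nP_iZ_iM(Z_i^\top Q_iZ_i)$ for $i=0,1$, and $$f(A_0,A_1)=\mathbb{E}\Big[\big([Z_2]_{d+1,n+1}+w_\star^\top x^{(n+1)}\big)^2\Big].$$ Then there are diagonal matrices $A_0$ and $A_1$ that are a global minimizer of $f$ over pairs of symmetric $d\times d$ matrices.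
   Context: $[X]_{i,j}$ denotes the $(i,j)$ entry of a matrix $X$; the expectation is over $x^{(1)},\dots,x^{(n+1)},w_\star$. *)

(* Defs.v *)
From HB Require Import structures.
From mathcomp Require Import all_boot all_order all_algebra.
From mathcomp Require Import all_classical all_reals all_analysis.
Set Implicit Arguments.
Unset Strict Implicit.
Unset Printing Implicit Defensive.
Import Order.TTheory GRing.Theory Num.Theory.
Local Open Scope classical_set_scope.
Local Open Scope ring_scope.

Section Defs.
Variable R : realType.

Definition Pmat (d : nat) : 'M[R]_(d.+1) :=
  \matrix_(i, j) ((i == ord_max) && (j == ord_max))%:R.

Definition Qmat (d : nat) (A : 'M[R]_d) : 'M[R]_(d.+1) :=
  \matrix_(i, j) match unlift ord_max i, unlift ord_max j with
                 | Some a, Some b => A a b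
                 | _, _ => 0 end.

Definition Mmat (n : nat) : 'M[R]_(n.+1) :=
  \matrix_(i, j) ((i == j) && (i != ord_max))%:R.

Definition Z0mat (d n : nat) (x : 'I_n.+1 -> 'I_d -> R) (w : 'I_d -> R)
  : 'M[R]_(d.+1, n.+1) :=
  \matrix_(i, j) match unlift ord_max i with
                 | Some a => x j a
                 | None => match unlift ord_max j with
                           | Some b => \sum_(k < d) x (lift ord_max b) k * w k
                           | None => 0 end end.

Definition step (d n : nat) (A : 'M[R]_d) (Z : 'M[R]_(d.+1, n.+1))
  : 'M[R]_(d.+1, n.+1) :=
  Z + (n%:R)^-1 *: (Pmat d *m Z *m Mmat n *m (Z^T *m Qmat A *m Z)).

Definition sq_err (d n : nat) (A0 A1 : 'M[R]_d)
  (x : 'I_n.+1 -> 'I_d -> R) (w : 'I_d -> R) : R :=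
  ((step A1 (step A0 (Z0mat x w))) ord_max ord_max
    + \sum_(k < d) w k * x ord_max k) ^+ 2.

Definition mutually_independent {dT : measure_display} (T : measurableType dT)
  (P : probability T R) (I : finType) (Y : I -> T -> R) : Prop :=
  forall B : I -> set R, (forall i, measurable (B i)) ->
    P (\bigcap_(i in [set: I]) (Y i @^-1` B i)) = (\prod_(i : I) P (Y i @^-1` B i))%E.

Definition std_normal {dT : measure_display} (T : measurableType dT)
  (P : probability T R) (Y : T -> R) : Prop :=
  measurable_fun [set: T] Y /\
  forall B : set R, measurable B -> P (Y @^-1` B) = normal_prob 0 1 B.

Definition ferr {dT : measure_display} (T : measurableType dT)
  (P : probability T R) (d n : nat)
  (X : 'I_n.+1 -> 'I_d -> T -> R) (W : 'I_d -> T -> R)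
  (A0 A1 : 'M[R]_d) : \bar R :=
  (\int[P]_t (sq_err A0 A1 (fun j k => X j k t) (fun k => W k t))%:E)%E.

End Defs.

(* Main.v *)
Require Import Defs.
From HB Require Import structures.
From mathcomp Require Import all_boot all_order all_algebra.
From mathcomp Require Import all_classical all_reals all_analysis.
From mathcomp Require Import finmap measurable_realfun ring lra.
Set Implicit Arguments.
Unset Strict Implicit.
Unset Printing Implicit Defensive.
Import Order.TTheory GRing.Theory Num.Theory.
Import numFieldNormedType.Exports.
Local Open Scope classical_set_scope.
Local Open Scope ring_scope.

(** Writing [G = n^-1 sum_(i <= n) x_i x_i^T], the error of the two-layer network
    is [w^T (1 + G A_0) (1 + G A_1) x_(n+1)], so [f] is the expectation of the
    square of a polynomial in independent standard Gaussians.

    Existence: replace the two identities by [a 1] and [b 1].  The expectation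
    becomes homogeneous of degree two in [(a, A_0)] and in [(b, A_1)], and it
    vanishes only if one of these pairs does (a polynomial whose square has
    expectation zero vanishes everywhere, and [G] may be taken of rank one).  By
    compactness of the product of the unit spheres it is bounded below by
    [m |(a, A_0)|^2 |(b, A_1)|^2] with [m > 0], so [f] attains its minimum.

    [A_0] diagonal: Gaussian integration by parts shows that [f] is invariant
    under simultaneous orthogonal conjugation of [A_0] and [A_1].  Among the
    minimizers pick one whose [A_0] has the largest sum of squares of diagonal
    entries; a nonzero off-diagonal entry of [A_0] would allow a Jacobi rotation
    to increase it.

    [A_1] diagonal: conjugation by diagonal sign matrices fixes the diagonal
    [A_0], and [f] is convex in [A_1]; averaging over the signs replaces [A_1] by
    its diagonal part without increasing [f]. *)

(** * Polynomial functions of finitely many real variables *)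

Section PolynomialFunctions.
Context {R : realType}.
Implicit Types (I J : finType).

(** A monomial is a coefficient with a word of variables, exponents being multiplicities of letters.
    No normal form is imposed, so sums and products are plain list operations. *)
Definition polyfun I (p : (I -> R) -> R) : Prop :=
  exists l : seq (R * seq I),
    forall v, p v = \sum_(m <- l) m.1 * \prod_(i <- m.2) v i.

Lemma eq_polyfun I (p q : (I -> R) -> R) : p =1 q -> polyfun p -> polyfun q.
Proof. by move=> pq [l lE]; exists l => v; rewrite -pq. Qed.

Lemma polyfun_cst I (c : R) : polyfun (fun _ : I -> R => c).
Proof.
by exists [:: (c, [::])] => v; rewrite big_seq1 big_nil mulr1.
Qed.

Lemma polyfun_var I (i : I) : polyfun (fun v => v i).
Proof.
by exists [:: (1, [:: i])] => v; rewrite !big_seq1 mul1r.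
Qed.

Lemma polyfunD I (p q : (I -> R) -> R) :
  polyfun p -> polyfun q -> polyfun (fun v => p v + q v).
Proof.
by move=> [l lE] [k kE]; exists (l ++ k) => v; rewrite big_cat lE kE.
Qed.

Lemma polyfunM I (p q : (I -> R) -> R) :
  polyfun p -> polyfun q -> polyfun (fun v => p v * q v).
Proof.
move=> [l lE] [k kE].
exists [seq (m1.1 * m2.1, m1.2 ++ m2.2) | m1 <- l, m2 <- k] => v.
rewrite big_allpairs_dep lE kE big_distrl/=; apply: eq_bigr => m1 _.
rewrite big_distrr/=; apply: eq_bigr => m2 _.
by rewrite big_cat/= mulrACA.
Qed.

Lemma polyfunX I (p : (I -> R) -> R) k :
  polyfun p -> polyfun (fun v => p v ^+ k).
Proof.
move=> pp; elim: k => [|k IH].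
  by apply: eq_polyfun (polyfun_cst I 1) => v; rewrite expr0.
by apply: eq_polyfun (polyfunM pp IH) => v; rewrite exprS.
Qed.

Lemma polyfunN I (p : (I -> R) -> R) :
  polyfun p -> polyfun (fun v => - p v).
Proof.
move=> pp; apply: eq_polyfun (polyfunM (polyfun_cst I (-1)) pp) => v.
by rewrite mulN1r.
Qed.

Lemma polyfunB I (p q : (I -> R) -> R) :
  polyfun p -> polyfun q -> polyfun (fun v => p v - q v).
Proof. by move=> pp qp; exact: polyfunD pp (polyfunN qp). Qed.

Lemma polyfun_sum I (S : Type) (r : seq S) (f : S -> (I -> R) -> R) :
  (forall s, polyfun (f s)) -> polyfun (fun v => \sum_(s <- r) f s v).
Proof.
move=> fp; elim: r => [|s r IH].
  by apply: eq_polyfun (polyfun_cst I 0) => v; rewrite big_nil.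
by apply: eq_polyfun (polyfunD (fp s) IH) => v; rewrite big_cons.
Qed.

Lemma polyfun_prod I (S : Type) (r : seq S) (f : S -> (I -> R) -> R) :
  (forall s, polyfun (f s)) -> polyfun (fun v => \prod_(s <- r) f s v).
Proof.
move=> fp; elim: r => [|s r IH].
  by apply: eq_polyfun (polyfun_cst I 1) => v; rewrite big_nil.
by apply: eq_polyfun (polyfunM (fp s) IH) => v; rewrite big_cons.
Qed.

(** Points are re-indexed as row vectors along [enum_rank], the space in which compactness of boxes
    is used below. *)
Lemma polyfun_continuous I (p : (I -> R) -> R) : polyfun p ->
  continuous (fun u : 'rV[R]_#|I| => p (fun i => u ord0 (enum_rank i))).
Proof.
move=> [l lE].
have cD (f g : 'rV[R]_#|I| -> R) : continuous f -> continuous g ->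
  continuous (fun u => f u + g u) by move=> cf cg u; exact: cvgD (cf u) (cg u).
have cM (f g : 'rV[R]_#|I| -> R) : continuous f -> continuous g ->
  continuous (fun u => f u * g u) by move=> cf cg u; exact: cvgM (cf u) (cg u).
have -> : (fun u : 'rV[R]_#|I| => p (fun i => u ord0 (enum_rank i))) =
    (fun u => \sum_(m <- l) m.1 * \prod_(i <- m.2) u ord0 (enum_rank i)).
  by apply/funext => w; rewrite lE.
elim: l {lE} => [|m l IH].
  rewrite (_ : (fun _ => _) = cst 0); first exact: cst_continuous.
  by apply/funext => u; rewrite big_nil.
under eq_fun do rewrite big_cons.
apply: cD; last exact: IH.
apply: (cM); first exact: cst_continuous.
elim: m.2 => [|i s IHs].
  rewrite (_ : (fun _ => _) = cst 1); first exact: cst_continuous.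
  by apply/funext => u; rewrite big_nil.
under eq_fun do rewrite big_cons.
by apply: cM IHs => u; exact: coord_continuous.
Qed.

Lemma polyfun_near I (p : (I -> R) -> R) (v : I -> R) (e : R) :
  polyfun p -> 0 < e ->
  exists2 r, 0 < r &
    forall w, (forall i, `|w i - v i| < r) -> `|p w - p v| < e.
Proof.
move=> pp e0.
pose row (w : I -> R) : 'rV[R]_#|I| := \row_j w (enum_val j).
have rowE w : (fun i => row w ord0 (enum_rank i)) = w.
  by apply/funext => i; rewrite mxE enum_rankK.
have := polyfun_continuous pp (x := row v).
move/cvgrPdist_lt => /(_ _ e0) /nbhs_ballP[r /= r0 rP].
exists r => // w wr; have := rP (row w).
rewrite /= !rowE distrC; apply; split=> // i j.
rewrite !mxE /ball /= distrC; exact: wr.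
Qed.

(** [K] is compact, being a box cut by closed conditions; [Z] may be any set of polynomial
    equations. This one statement serves the unit spheres, the minimization itself, and the choice
    among minimizers. *)
Lemma polyfun_argmin I (p : (I -> R) -> R) (M : R)
    (Z : set ((I -> R) -> R)) (v0 : I -> R) :
  polyfun p -> (forall g, Z g -> polyfun g) ->
  let K := [set v | (forall i, `|v i| <= M) /\ forall g, Z g -> g v = 0] in
  K v0 -> exists2 v, K v & forall w, K w -> p v <= p w.
Proof.
move=> pp Zp K Kv0.
pose row (w : I -> R) : 'rV[R]_#|I| := \row_j w (enum_val j).
pose fn (u : 'rV[R]_#|I|) := (fun i => u ord0 (enum_rank i)).
have rowE w : fn (row w) = w.
  by apply/funext => i; rewrite /fn mxE enum_rankK.
pose K' := [set u | K (fn u)].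
have K'E : K' = [set u : 'rV[R]_#|I| | forall j, `[- M, M]%classic (u ord0 j)] `&`
    \bigcap_(g in Z) ((fun u => g (fn u)) @^-1` [set 0]).
  apply/seteqP; split => u /=.
    move=> [uM uZ]; split; last by move=> g Zg; exact: uZ.
    by move=> j; rewrite /= in_itv/= -ler_norml -(enum_valK j); exact: uM.
  move=> [uM uZ]; split; last by move=> g Zg; exact: uZ.
  by move=> i; rewrite ler_norml; have := uM (enum_rank i); rewrite /= in_itv.
have cK' : compact K'.
  rewrite K'E; apply: compact_closedI.
    by apply: (@rV_compact _ _ (fun=> `[- M, M]%classic)) => _; exact: segment_compact.
  apply: closed_bigI => g Zg.
  apply: preimage_closed; last exact: closed_eq.
  by move=> u _; exact: (polyfun_continuous (Zp g Zg)).
have [||u /set_mem Ku umin] := @compact_EVT_min _ _ (fun u => p (fn u)) _ _ cK'.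
- by exists (row v0); rewrite /K' /= rowE.
- by apply: continuous_subspaceT; exact: polyfun_continuous.
exists (fn u) => // w Kw; have := umin (row w).
by rewrite rowE; apply; apply/mem_set; rewrite /K' /= rowE.
Qed.

End PolynomialFunctions.

(** * Equality of integrals from equality on Borel sets *)

Section Transport.
Context {R : realType}.
Import HBSimple HBNNSimple.

(** A simple function of [Y] is a finite combination of indicators of preimages under [Y], and these
    are the only sets on which [eqG] gives information. *)
Lemma integral_nnsfun_comp d (T : measurableType d)
    (m : {measure set T -> \bar R}) (Y G : T -> R) (g : {nnsfun R >-> R}) :
  measurable_fun setT Y -> m.-integrable setT (EFin \o G) ->
  m.-integrable setT (fun t => (g (Y t) * G t)%:E) /\
  (\int[m]_t (g (Y t) * G t)%:E = \sum_(y <- fset_set (range g))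
     y%:E * \int[m]_(t in Y @^-1` (g @^-1` [set y])) (G t)%:E)%E.
Proof.
move=> mY iG.
pose A y : set T := Y @^-1` (g @^-1` [set y]).
have mA y : measurable (A y).
  by rewrite -[A y]setTI; apply: mY => //; exact: measurable_funPTI.
have gE t : (g (Y t) * G t)%:E =
    (\sum_(y <- fset_set (range g)) (y%:E * ((EFin \o G) \_ (A y)) t))%E.
  rewrite fimfunE fsbig_finite//= mulr_suml -sumEFin.
  apply: eq_bigr => y _; rewrite -mulrA EFinM; congr (_ * _)%E.
  rewrite patchE indicE; have -> : (Y t \in g @^-1` [set y]) = (t \in A y).
    by apply/idP/idP => /set_mem h; apply/mem_set.
  by case: ifP => _; rewrite ?mul1r ?mul0r.
have iA y : m.-integrable setT (fun t => y%:E * ((EFin \o G) \_ (A y)) t)%E.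
  apply: integrableZl => //; rewrite -integrable_mkcond//.
  exact: integrableS iG.
split.
  rewrite (_ : (fun _ => _) = fun t =>
    (\sum_(y <- fset_set (range g)) (y%:E * ((EFin \o G) \_ (A y)) t))%E).
    exact: integrable_sum.
  by apply/funext => t; exact: gE.
under eq_integral do rewrite gE.
rewrite integral_sum//; apply: eq_bigr => y _.
rewrite integralZl//; last first.
  rewrite -integrable_mkcond//; exact: integrableS iG.
by rewrite -integral_mkcond.
Qed.

Context d1 (T1 : measurableType d1) (m1 : {measure set T1 -> \bar R})
        d2 (T2 : measurableType d2) (m2 : {measure set T2 -> \bar R}).
Variables (Y1 G1 : T1 -> R) (Y2 G2 : T2 -> R).
Hypothesis mY1 : measurable_fun setT Y1.
Hypothesis mY2 : measurable_fun setT Y2.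
Hypothesis iG1 : m1.-integrable setT (EFin \o G1).
Hypothesis iG2 : m2.-integrable setT (EFin \o G2).
Hypothesis eqG : forall B : set R, measurable B ->
  (\int[m1]_(t in Y1 @^-1` B) (G1 t)%:E =
   \int[m2]_(t in Y2 @^-1` B) (G2 t)%:E)%E.

Lemma transport_nnsfun (g : {nnsfun R >-> R}) :
  (\int[m1]_t (g (Y1 t) * G1 t)%:E = \int[m2]_t (g (Y2 t) * G2 t)%:E)%E.
Proof.
rewrite (integral_nnsfun_comp g mY1 iG1).2 (integral_nnsfun_comp g mY2 iG2).2.
apply: eq_bigr => y _; rewrite eqG//; exact: measurable_funPTI.
Qed.

(** Monotone convergence needs [G] nonnegative but no integrability of [h (Y t) * G t], so the
    resulting transport can be used to prove integrability. *)
Lemma cvg_integral_ge0 d (T : measurableType d)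
    (m : {measure set T -> \bar R}) (Y G : T -> R) (h : R -> R)
    (mh : measurable_fun [set: R] (fun x => (h x)%:E)) :
  measurable_fun setT Y -> m.-integrable setT (EFin \o G) ->
  (forall x, 0 <= h x) -> (forall t, 0 <= G t) ->
  (\int[m]_t (nnsfun_approx measurableT mh n (Y t) * G t)%:E @[n --> \oo]
    --> \int[m]_t (h (Y t) * G t)%:E)%E.
Proof.
move=> mY iG h0 G0.
have mG : measurable_fun setT G by apply/measurable_EFinP; exact: measurable_int iG.
rewrite [X in _ --> X](_ : _ = \int[m]_t
    limn (fun n => (nnsfun_approx measurableT mh n (Y t) * G t)%:E))%E.
  apply: cvg_monotone_convergence => //.
  - move=> n; apply/measurable_EFinP/measurable_funM => //.
    exact: measurableT_comp.
  - by move=> n t _; rewrite lee_fin mulr_ge0.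
  - move=> t _ a b ab; rewrite lee_fin ler_wpM2r//.
    exact/lefP/nd_nnsfun_approx.
apply: eq_integral => t _; apply/esym/cvg_lim => //=.
rewrite EFinM; under eq_fun do rewrite EFinM.
apply: cvgeZr => //.
by apply: (@cvg_nnsfun_approx _ _ _ _ measurableT _ mh) => // x _; rewrite lee_fin.
Qed.

Lemma transport_ge0 (h : R -> R) : measurable_fun setT h ->
  (forall x, 0 <= h x) -> (forall t, 0 <= G1 t) -> (forall t, 0 <= G2 t) ->
  (\int[m1]_t (h (Y1 t) * G1 t)%:E = \int[m2]_t (h (Y2 t) * G2 t)%:E)%E.
Proof.
move=> mh h0 G10 G20.
have mh' : measurable_fun [set: R] (fun x => (h x)%:E) by exact/measurable_EFinP.
have c1 := cvg_integral_ge0 mh' mY1 iG1 h0 G10.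
have c2 := cvg_integral_ge0 mh' mY2 iG2 h0 G20.
rewrite -(cvg_lim _ c1)// -(cvg_lim _ c2)//.
by under eq_fun do rewrite transport_nnsfun.
Qed.

(** For signed [G] the approximations are no longer monotone; they are dominated by the absolute
    value of the limit instead. *)
Lemma cvg_integral_dominated d (T : measurableType d)
    (m : {measure set T -> \bar R}) (Y G : T -> R) (h : R -> R)
    (mh : measurable_fun [set: R] (fun x => (h x)%:E)) :
  measurable_fun setT Y -> m.-integrable setT (EFin \o G) ->
  (forall x, 0 <= h x) ->
  m.-integrable setT (fun t => (h (Y t) * G t)%:E) ->
  (\int[m]_t (nnsfun_approx measurableT mh n (Y t) * G t)%:E @[n --> \oo]
    --> \int[m]_t (h (Y t) * G t)%:E)%E.
Proof.
move=> mY iG h0 ihG.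
have mG : measurable_fun setT G by apply/measurable_EFinP; exact: measurable_int iG.
have [] // := @dominated_convergence _ _ _ m setT measurableT
  (fun n t => (nnsfun_approx measurableT mh n (Y t) * G t)%:E)
  (fun t => (h (Y t) * G t)%:E) (fun t => `|(h (Y t) * G t)%:E|)%E.
- move=> n; apply/measurable_EFinP/measurable_funM => //.
  exact: measurableT_comp.
- exact: measurable_int ihG.
- apply: aeW => t _; rewrite EFinM; under eq_fun do rewrite EFinM.
  apply: cvgeZr => //.
  by apply: (@cvg_nnsfun_approx _ _ _ _ measurableT _ mh) => // x _; rewrite lee_fin.
- exact: integrable_abse.
- apply: aeW => t n _; rewrite /= lee_fin !normrM ler_wpM2r//.
  rewrite !ger0_norm// -lee_fin nnsfun_approxE.
  by apply: le_approx => // x _; rewrite lee_fin.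
Qed.

(** The positive and negative parts of [h] are treated separately. The lemma is used both to pass
    from a law to its density and to replace an independent factor by its mean. *)
Lemma transport (h : R -> R) : measurable_fun setT h ->
  m1.-integrable setT (fun t => (h (Y1 t) * G1 t)%:E) ->
  m2.-integrable setT (fun t => (h (Y2 t) * G2 t)%:E) ->
  \int[m1]_t (h (Y1 t) * G1 t) = \int[m2]_t (h (Y2 t) * G2 t).
Proof.
have ge0 (k : R -> R) : measurable_fun setT k -> (forall x, 0 <= k x) ->
    m1.-integrable setT (fun t => (k (Y1 t) * G1 t)%:E) ->
    m2.-integrable setT (fun t => (k (Y2 t) * G2 t)%:E) ->
    \int[m1]_t (k (Y1 t) * G1 t) = \int[m2]_t (k (Y2 t) * G2 t).
  move=> mk k0 i1 i2; congr fine.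
  have mk' : measurable_fun [set: R] (fun x => (k x)%:E) by exact/measurable_EFinP.
  have c1 := cvg_integral_dominated mk' mY1 iG1 k0 i1.
  have c2 := cvg_integral_dominated mk' mY2 iG2 k0 i2.
  rewrite -(cvg_lim _ c1)// -(cvg_lim _ c2)//.
  by under eq_fun do rewrite transport_nnsfun.
move=> mh i1 i2.
have part d (T : measurableType d) (m : {measure set T -> \bar R})
    (Y G : T -> R) (k : R -> R) : measurable_fun setT Y ->
    m.-integrable setT (EFin \o G) -> measurable_fun setT k ->
    (forall x, `|k x| <= `|h x|) ->
    m.-integrable setT (fun t => (h (Y t) * G t)%:E) ->
    m.-integrable setT (fun t => (k (Y t) * G t)%:E).
  move=> mY iG mk kh; apply: le_integrable => //.
    apply/measurable_EFinP/measurable_funM; first exact: measurableT_comp.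
    by apply/measurable_EFinP; exact: measurable_int iG.
  by move=> t _; rewrite /= lee_fin !normrM ler_wpM2r.
have mp : measurable_fun setT h^\+ by exact: measurable_funrpos.
have mn : measurable_fun setT h^\- by exact: measurable_funrneg.
have ph x : `|h^\+ x| <= `|h x|.
  by rewrite /funrpos ger0_norm ?le_max ?lexx ?orbT// ge_max ler_norm normr_ge0.
have nh x : `|h^\- x| <= `|h x|.
  rewrite /funrneg ger0_norm ?le_max ?lexx ?orbT// ge_max normr_ge0 andbT.
  by rewrite -normrN ler_norm.
have hE x : h x = h^\+ x - h^\- x.
  by have /(congr1 (@^~ x)) := funrposBneg h.
have split d (T : measurableType d) (m : {measure set T -> \bar R})
    (Y G : T -> R) : measurable_fun setT Y ->
    m.-integrable setT (EFin \o G) ->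
    m.-integrable setT (fun t => (h (Y t) * G t)%:E) ->
    \int[m]_t (h (Y t) * G t) =
    \int[m]_t (h^\+ (Y t) * G t) - \int[m]_t (h^\- (Y t) * G t).
  move=> mY iG ihG; rewrite -RintegralB//.
  - by apply: eq_Rintegral => t _; rewrite hE mulrBl.
  - exact: part ihG.
  - exact: part ihG.
rewrite (split _ _ _ _ _ mY1 iG1 i1) (split _ _ _ _ _ mY2 iG2 i2).
congr (_ - _).
- by apply: ge0 => //; [exact: part i1|exact: part i2].
- by apply: ge0 => //; [exact: part i1|exact: part i2].
Qed.

End Transport.

(** * Moments of the standard normal distribution *)

Section NormalMoments.
Context {R : realType}.
Notation mu := (@lebesgue_measure R).
Notation phi := (@normal_pdf R 0 1).

Lemma std_normal_pdfE (x : R) :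
  phi x = normal_peak 1 * expR (- (x ^+ 2 / 2)).
Proof.
rewrite normal_pdfE ?oner_eq0// /normal_fun subr0 expr1n.
by congr (_ * expR _); rewrite mulNr.
Qed.

Lemma measurable_std_normal_pdf : measurable_fun setT (phi : R -> R).
Proof. exact: measurable_normal_pdf. Qed.

(* [x ^ 2k = 4 ^ k (x ^ 2 / 4) ^ k <= 4 ^ k k! exp (x ^ 2 / 4)], so a power
   times the standard density is dominated by the density of variance 2. *)
Lemma std_normal_pdf_dominated k : exists2 C : R, 0 <= C &
  forall x, `|x| ^+ k * phi x <= C * normal_pdf 0 (Num.sqrt 2) x.
Proof.
have s0 : Num.sqrt 2 != 0 :> R by rewrite gt_eqF// sqrtr_gt0 ltr0n.
have p1 : 0 < normal_peak 1 :> R by apply: normal_peak_gt0; rewrite oner_eq0.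
have p2 : 0 < normal_peak (Num.sqrt 2) :> R by apply: normal_peak_gt0.
pose D : R := 1 + 4 ^+ k * k`!%:R.
have D0 : 0 <= D by rewrite addr_ge0// mulr_ge0// exprn_ge0.
exists (normal_peak 1 * D / normal_peak (Num.sqrt 2)) => [|x].
  by rewrite divr_ge0 ?mulr_ge0 ?normal_peak_ge0.
rewrite std_normal_pdfE normal_pdfE// /normal_fun subr0 sqr_sqrtr//.
rewrite mulrCA [leRHS]mulrA divfK ?gt_eqF// -[leRHS]mulrA ler_pM2l//.
have -> : - (x ^+ 2 / 2) = x ^+ 2 * -4^-1 + - x ^+ 2 / (2 *+ 2) :> R.
  by field.
rewrite expRD mulrA ler_pM2r ?expR_gt0//.
rewrite mulrN expRN ler_pdivrMr ?expR_gt0//.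
set y := x ^+ 2 * 4^-1.
have y0 : 0 <= y by rewrite mulr_ge0 ?sqr_ge0.
(* Passing to the even power [2k], via [t <= 1 + t ^ 2], also covers odd [k]. *)
have x4 : `|x| ^+ k <= 1 + 4 ^+ k * y ^+ k.
  rewrite -exprMn /y mulrCA divff// mulr1 -real_normK ?num_real// -exprM mulnC exprM.
  by have := sqr_ge0 (`|x| ^+ k - 1); nra.
apply: (le_trans x4); rewrite /D mulrDl mul1r lerD//.
  by rewrite -expR0 ler_expR.
rewrite -mulrA ler_wpM2l ?exprn_ge0//.
case: k {D D0 x4} => [|k]; first by rewrite expr0 mul1r -expR0 ler_expR.
rewrite mulrC -ler_pdivrMr ?ltr0n ?fact_gt0//.
by apply: le_trans (expR_ge1Dxn k y0); rewrite lerDr.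
Qed.

Lemma integrable_moment k : mu.-integrable setT (fun x => (x ^+ k * phi x)%:E).
Proof.
have [C C0 CP] := std_normal_pdf_dominated k.
have := integrable_normal_pdf 0 (Num.sqrt 2 : R).
move=> /(@integrableZl _ _ _ mu setT measurableT C); apply: le_integrable => //.
  apply/measurable_EFinP/measurable_funM; first exact: measurable_funX.
  exact: measurable_std_normal_pdf.
move=> x _; rewrite /= lee_fin normrM normrX (ger0_norm (normal_pdf_ge0 _ _ _)).
by rewrite [leRHS]ger0_norm ?mulr_ge0 ?normal_pdf_ge0.
Qed.

Lemma is_derive_moment k (x : R) :
  is_derive x 1 (fun x => x ^+ k * phi x)
    (k%:R * x ^+ k.-1 * phi x - x ^+ k.+1 * phi x).
Proof.
have -> : (fun x : R => x ^+ k * phi x) =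
    (fun x => x ^+ k * (normal_peak 1 * expR (- (x ^+ 2 / 2)))).
  by apply/funext => y; rewrite std_normal_pdfE.
rewrite std_normal_pdfE.
have dE : is_derive x 1 (fun x : R => - (x ^+ 2 / 2)) (- x).
  by apply: is_derive_eq; rewrite /GRing.scale/=; field.
have dexp : is_derive x 1 (fun x : R => expR (- (x ^+ 2 / 2)))
    (expR (- (x ^+ 2 / 2)) * - x).
  exact: (@is_derive1_comp _ (@expR R) (fun x : R => - (x ^+ 2 / 2)) x _ _
    (is_derive_expR _) dE).
have dk : is_derive x 1 (fun x : R => x ^+ k) (k%:R * x ^+ k.-1).
  have := @is_deriveX R R id k x 1 1 (is_derive_id x 1).
  rewrite (_ : id ^+ k = (fun x : R => x ^+ k)); last first.
    by apply/funext => y; elim: k => //= k IH; rewrite !exprS -IH.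
  by rewrite /GRing.scale/= mulr1.
set p := normal_peak 1; set e := expR (- (x ^+ 2 / 2)).
have := is_deriveM dk (is_deriveZ p dexp).
move/is_derive_eq; apply.
transitivity (x ^+ k * (p * (e * - x)) + p * e * (k%:R * x ^+ k.-1)); first by [].
rewrite (exprS x k); ring.
Qed.

Lemma integral_moment_bounded k (a : R) : 0 < a ->
  (\int[mu]_(x in `[(- a)%R, a]) (k%:R * x ^+ k.-1 * phi x - x ^+ k.+1 * phi x)%:E =
   (a ^+ k * phi a - (- a) ^+ k * phi (- a))%:E)%E.
Proof.
move=> a0; rewrite EFinB.
have phic : continuous (phi : R -> R).
  by apply: continuous_normal_pdf; rewrite oner_eq0.
have Fc : continuous (fun x : R => x ^+ k * phi x).
  by move=> x; apply: cvgM; [exact: exprn_continuous|exact: phic].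
apply: (@continuous_FTC2 _ _ (fun x => x ^+ k * phi x)).
- by rewrite gtrN.
- apply: continuous_subspaceT => x; apply: cvgB; apply: cvgM => //.
  + by apply: cvgM; [exact: cvg_cst|exact: exprn_continuous].
  + exact: phic.
  + exact: exprn_continuous.
  + exact: phic.
- split=> [x _||].
  + by have [] := is_derive_moment k x.
  + exact/cvg_at_right_filter/Fc.
  + exact/cvg_at_left_filter/Fc.
- move=> x _; rewrite derive1E; exact: (@derive_val _ _ _ _ _ _ _ (is_derive_moment k x)).
Qed.

Lemma std_normal_pdfN (x : R) : phi (- x) = phi x.
Proof. by rewrite !std_normal_pdfE sqrrN. Qed.

(** The domination with one extra power, [k.+1], leaves a factor [1 / n.+1], so the boundary terms
    are bounded by a multiple of the harmonic sequence. *)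
Lemma cvg_moment_boundary k :
  ((n.+1%:R ^+ k * phi n.+1%:R - (- n.+1%:R) ^+ k * phi (- n.+1%:R)) @[n --> \oo]
    --> (0 : R)).
Proof.
have [C C0 CP] := std_normal_pdf_dominated k.+1.
pose D := C * normal_peak (Num.sqrt 2).
have bd n : `|n.+1%:R ^+ k * phi n.+1%:R - (- n.+1%:R) ^+ k * phi (- n.+1%:R)|
    <= 2 * D * @harmonic R n.
  have s0 : Num.sqrt 2 != 0 :> R by rewrite gt_eqF// sqrtr_gt0 ltr0n.
  rewrite std_normal_pdfN; apply: (le_trans (ler_normB _ _)).
  rewrite !normrM !normrX normrN (ger0_norm (normal_pdf_ge0 _ _ _)).
  have /= : 0 < n.+1%:R :> R by rewrite ltr0n.
  set x : R := n.+1%:R => x0.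
  have := le_trans (CP x) (ler_wpM2l C0 (normal_pdf_ub 0 x s0)).
  rewrite (ger0_norm (ltW x0)) -/D exprS -mulrA -ler_pdivlMl// => h.
  by rewrite -mulr2n -[leRHS]mulrA (mulrC D) mulr_natl lerMn2r h orbT.
have bd0 : 2 * D * @harmonic R n @[n --> \oo] --> (0 : R).
  rewrite -[X in _ --> X](mulr0 (2 * D)); apply: cvgM; first exact: cvg_cst.
  exact: cvg_harmonic.
apply: (squeeze_cvgr (f := fun n => - (2 * D * @harmonic R n)) _ _ bd0).
- by apply: nearW => n; rewrite -ler_norml bd.
- by rewrite -oppr0; exact: cvgN.
Qed.

(** The derivative of [x ^+ k * phi x] has integral zero, since [phi' = - x phi] and the boundary
    terms vanish. For [k = 0] the factor [k%:R] kills the right side, so the truncated [k.-1] is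
    harmless. *)
Lemma moment_rec k :
  \int[mu]_x (x ^+ k.+1 * phi x) = k%:R * \int[mu]_x (x ^+ k.-1 * phi x).
Proof.
pose f (x : R) := k%:R * x ^+ k.-1 * phi x - x ^+ k.+1 * phi x.
have if1 : mu.-integrable setT (EFin \o (fun x : R => k%:R * (x ^+ k.-1 * phi x))).
  have := integrableZl measurableT k%:R (integrable_moment k.-1).
  by apply: eq_integrable => // x _.
have fi : mu.-integrable setT (EFin \o f).
  have := integrableB measurableT if1 (integrable_moment k.+1).
  by apply: eq_integrable => // x _; rewrite /f /= mulrA EFinB.
have mf : measurable_fun setT f by apply/measurable_EFinP; exact: measurable_int fi.
suff : \int[mu]_x f x = 0.
  rewrite (_ : f = fun x => k%:R * (x ^+ k.-1 * phi x) - x ^+ k.+1 * phi x).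
    rewrite RintegralB//; last exact: integrable_moment.
    rewrite RintegralZl//; last exact: integrable_moment.
    by move/eqP; rewrite subr_eq0 => /eqP.
  by apply/funext => x; rewrite /f mulrA.
(* These intervals exhaust the line; dominated convergence extends the identity on each of them to
   the full integral. *)
pose I n : set R := `[(- n.+1%:R)%R, n.+1%:R]%classic.
have [] // := @dominated_convergence _ _ _ mu setT measurableT
  (fun n => (EFin \o f) \_ (I n)) (EFin \o f) (abse \o (EFin \o f)).
- move=> n; apply/(measurable_restrictT _ _).1 => //; first exact: measurable_itv.
  exact: measurable_funTS (measurable_int mu fi).
- exact/measurable_EFinP.
- apply: aeW => x _; apply: cvg_near_cst.
  near=> n; rewrite patchE mem_set// /I/= in_itv/= -ler_norml.
  apply: (@le_trans _ _ n%:R); last by rewrite ler_nat.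
  near: n; exact: nbhs_infty_ger.
- exact: integrable_abse.
- apply: aeW => x n _; rewrite patchE; case: ifP => _ //=.
  by rewrite normr0 lee_fin.
move=> _ _ cv; rewrite /Rintegral.
rewrite -(cvg_lim _ cv)//.
have -> : (fun n => \int[mu]_x ((EFin \o f) \_ (I n)) x)%E =
  EFin \o (fun n => n.+1%:R ^+ k * phi n.+1%:R - (- n.+1%:R) ^+ k * phi (- n.+1%:R)).
  apply/funext => n; rewrite -integral_mkcond /= -integral_moment_bounded//.
have /cvg_lim -> // : ((n.+1%:R ^+ k * phi n.+1%:R -
    (- n.+1%:R) ^+ k * phi (- n.+1%:R))%:E @[n --> \oo] --> 0%:E)%E.
apply: cvg_EFin; last exact: cvg_moment_boundary.
by apply: nearW.
Unshelve. all: by end_near. Qed.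

End NormalMoments.

(** * Families of independent standard normal variables *)

Section AllMoments.
Context {R : realType} {dT : measure_display} {T : measurableType dT}.
Variable P : probability T R.
Implicit Types Y Z : T -> R.

(** Unlike integrability alone, integrability of all powers is stable under products. *)
Definition all_moments Y := measurable_fun setT Y /\
  forall k, P.-integrable setT (fun t => (Y t ^+ k)%:E).

Lemma all_moments_integrable Y : all_moments Y ->
  P.-integrable setT (fun t => (Y t)%:E).
Proof. by move=> [_ /(_ 1%N)]; under eq_fun do rewrite expr1. Qed.

Lemma all_moments_bounded Y (M : R) :
  measurable_fun setT Y -> (forall t, `|Y t| <= M) -> all_moments Y.
Proof.
move=> mY YM; split=> // k.
have := finite_measure_integrable_cst P (M ^+ k) measurableT.
apply: le_integrable => //.
  by apply/measurable_EFinP; exact: measurable_funX.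
move=> t _; rewrite /= lee_fin normrX.
have M0 : 0 <= M by exact: le_trans (YM t).
by rewrite [leRHS]ger0_norm ?exprn_ge0// lerXn2r ?nnegrE.
Qed.

(** From [|y z| <= y ^ 2 + z ^ 2] with [y = Y ^ k] and [z = Z ^ k]: the powers [2k] of the factors
    control the power [k] of the product. *)
Lemma all_momentsM Y Z :
  all_moments Y -> all_moments Z -> all_moments (fun t => Y t * Z t).
Proof.
move=> [mY iY] [mZ iZ].
have mYZ : measurable_fun setT (fun t => Y t * Z t) by exact: measurable_funM.
split=> // k.
have := integrableD measurableT (iY (k * 2)%N) (iZ (k * 2)%N).
apply: le_integrable => //.
  by apply/measurable_EFinP; exact: measurable_funX.
move=> t _; rewrite /= lee_fin exprMn normrM !exprM.
set y := Y t ^+ k; set z := Z t ^+ k.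
rewrite [leRHS]ger0_norm ?addr_ge0 ?sqr_ge0//.
rewrite -(real_normK (num_real y)) -(real_normK (num_real z)).
have := normr_ge0 y; have := normr_ge0 z; have := sqr_ge0 (`|y| - `|z|).
by move: `|y| `|z| => a b; nra.
Qed.

Lemma all_moments_prod (I : Type) (r : seq I) (Y : I -> T -> R) :
  (forall i, all_moments (Y i)) -> all_moments (fun t => \prod_(i <- r) Y i t).
Proof.
move=> aY; elim: r => [|i r IH].
  under eq_fun do rewrite big_nil.
  by apply: (@all_moments_bounded _ 1) => // t; rewrite normr1.
by under eq_fun do rewrite big_cons; exact: all_momentsM.
Qed.

End AllMoments.

(** * Independence, mixed moments and integration by parts for monomials *)

Section GaussianFamily.
Context {R : realType} {dT : measure_display} {T : measurableType dT}.
Variables (P : probability T R) (I : finType) (xi : I -> T -> R).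
Hypothesis hind : mutually_independent P xi.
Hypothesis hN : forall i, std_normal P (xi i).
Notation mu := (@lebesgue_measure R).
Notation phi := (@normal_pdf R 0 1).

Let mxi i : measurable_fun setT (xi i) := (hN i).1.

(** The law of [xi i] in the shape of [eqG]: weight 1 on the probability space against weight [phi]
    on the line. *)
Let law_transport i (B : set R) : measurable B ->
  (\int[P]_(t in xi i @^-1` B) 1%:E = \int[mu]_(x in id @^-1` B) (phi x)%:E)%E.
Proof.
move=> mB; rewrite integral_cst ?mul1e; first exact: (hN i).2.
by rewrite -[_ @^-1` _]setTI; exact: mxi.
Qed.

Let int1 : P.-integrable setT (EFin \o (fun=> 1 : R)).
Proof. exact: finite_measure_integrable_cst. Qed.

Let iphi : mu.-integrable setT (EFin \o phi).
Proof. exact: integrable_normal_pdf. Qed.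

(** Integrability is the goal here, so the nonnegative transport is applied to the absolute value of
    the power. *)
Lemma all_moments_normal i : all_moments P (xi i).
Proof.
split=> // k; apply/integrableP; split.
  by apply/measurable_EFinP; exact: measurable_funX.
have := @transport_ge0 _ _ _ P _ _ mu (xi i) (fun=> 1) id phi (mxi i)
  (@measurable_id _ _ _) int1 iphi (@law_transport i) (fun x => `|x ^+ k|).
have mX : measurable_fun [set: R] (fun x : R => `|x ^+ k|).
  by apply: measurableT_comp => //; exact: measurable_funX.
move=> /(_ mX (fun=> normr_ge0 _) (fun=> ler01) (normal_pdf_ge0 0 1)).
under eq_integral do rewrite mulr1.
move=> ->; have /integrableP[_] := integrable_moment (R := R) k.
rewrite (_ : \int[mu]_x _ = \int[mu]_x (`|x ^+ k| * phi x)%:E)%E//.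
by apply: eq_integral => x _; rewrite /= normrM (ger0_norm (normal_pdf_ge0 _ _ x)).
Qed.

Lemma moment_normal i k :
  \int[P]_t (xi i t ^+ k) = \int[mu]_x (x ^+ k * phi x).
Proof.
rewrite -(@transport _ _ _ P _ _ mu (xi i) (fun=> 1) id phi (mxi i)
  (@measurable_id _ _ _) int1 iphi (@law_transport i) (fun x => x ^+ k)).
- by apply: eq_Rintegral => t _; rewrite mulr1.
- exact: measurable_funX.
- by under eq_fun do rewrite mulr1; exact: (all_moments_normal i).2.
- exact: integrable_moment.
Qed.

Lemma Rintegral_indicM (A : set T) (G : T -> R) : measurable A ->
  \int[P]_t (\1_A t * G t) = \int[P]_(t in A) G t.
Proof.
move=> mA; rewrite [RHS]Rintegral_mkcond; apply: eq_Rintegral => t _.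
by rewrite patchE indicE; case: ifP => _; rewrite ?mul1r ?mul0r.
Qed.

Lemma Rintegral_indic (A : set T) : measurable A ->
  \int[P]_t \1_A t = fine (P A).
Proof. by move=> mA; rewrite /Rintegral integral_indic// setIT. Qed.

Lemma expectation_prod_indic (B : I -> set R) : (forall i, measurable (B i)) ->
  \int[P]_t (\prod_i \1_(B i) (xi i t)) = \prod_i \int[P]_t \1_(B i) (xi i t).
Proof.
move=> mB.
have mxB i : measurable (xi i @^-1` B i).
  by rewrite -[_ @^-1` _]setTI; exact: mxi.
have indE i t : \1_(B i) (xi i t) = \1_(xi i @^-1` B i) t :> R by rewrite !indicE.
have -> : \prod_i \int[P]_t \1_(B i) (xi i t) = fine (P (\bigcap_(i in [set: I]) (xi i @^-1` B i))).
  rewrite hind//; transitivity (fine (\prod_i fine (P (xi i @^-1` B i)))%:E).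
    by apply: eq_bigr => i _; rewrite -Rintegral_indic//.
  congr fine; rewrite (big_morph EFin EFinM (erefl 1%:E)).
  by apply: eq_bigr => i _; rewrite fineK// fin_num_measure.
rewrite -Rintegral_indic; last first.
  by apply: fin_bigcap_measurable => //; exact: finite_finset.
apply: eq_Rintegral => t _; under eq_bigr do rewrite indE indicE.
rewrite indicE; have [h|h] := boolP (t \in _).
  rewrite big1// => i _; rewrite (_ : _ \in _ = true)//.
  by apply/mem_set; move/set_mem : h => /(_ i Logic.I).
have [i hi] : exists i, t \notin xi i @^-1` B i.
  apply/not_existsP => H; move/negP : h; apply; apply/mem_set => i _.
  by apply/set_mem; have /negP/negPn := H i.
by rewrite (bigD1 i)//= (negbTE hi) mul0r.
Qed.

(* Indicators are traded for arbitrary functions one index at a time: both sides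
   are integrals of [g i] against set functions that agree on Borel sets. *)
Lemma expectation_prod_partial (r : seq I) (g : I -> R -> R) : uniq r ->
  (forall i, measurable_fun setT (g i)) ->
  (forall i, all_moments P (fun t => g i (xi i t))) ->
  (forall i, i \notin r -> exists2 B, measurable B & g i = \1_B) ->
  \int[P]_t (\prod_i g i (xi i t)) = \prod_i \int[P]_t (g i (xi i t)).
Proof.
elim: r g => [|i r IH] g /=.
  move=> _ mg _ gB.
  have /choice[B BP] : forall i, exists B, measurable B /\ g i = \1_B.
    by move=> i; have [B mB ->] := gB i isT; exists B.
  under eq_Rintegral => t _ do under eq_bigr => i _ do rewrite (BP i).2.
  under [RHS]eq_bigr => i _ do rewrite (BP i).2.
  by apply: expectation_prod_indic => i; exact: (BP i).1.
move=> /andP[ir ur] mg ag gB.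
pose G t := \prod_(j | j != i) g j (xi j t).
pose c := \prod_(j | j != i) \int[P]_t (g j (xi j t)).
have aG : all_moments P G.
  rewrite /G; under eq_fun do rewrite -big_filter.
  exact: all_moments_prod.
have indP (B : set R) : measurable B ->
    \int[P]_t (\1_B (xi i t) * G t) = \int[P]_t (\1_B (xi i t)) * c.
  move=> mB.
  (* With an indicator at [i], only the indices of the shorter list [r] can carry a general
     function, so the induction hypothesis applies. *)
  pose g' j := if j == i then \1_B else g j.
  have g'i : g' i = \1_B by rewrite /g' eqxx.
  have g'j j : j != i -> g' j = g j by rewrite /g' => /negbTE ->.
  have mind : measurable_fun setT (\1_B : R -> R) by exact: measurable_indic.
  transitivity (\int[P]_t \prod_j g' j (xi j t)).
    apply: eq_Rintegral => t _; rewrite (bigD1 i)//= g'i; congr (_ * _).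
    by apply: eq_bigr => j ji; rewrite g'j.
  rewrite (IH g' ur).
  - rewrite (bigD1 i)//= g'i; congr (_ * _).
    by apply: eq_bigr => j ji; rewrite g'j.
  - by move=> j; rewrite /g'; case: eqP.
  - move=> j; rewrite /g'; case: eqP => // _.
    apply: (@all_moments_bounded _ _ _ _ _ 1); first exact: measurableT_comp.
    by move=> t; rewrite indicE; case: (_ \in _); rewrite ?normr0 ?normr1.
  - move=> j jr; have [->|ji] := eqVneq j i; first by rewrite g'i; exists B.
    by rewrite g'j//; apply: gB; rewrite inE negb_or ji.
(* The choice of the whole line for [B] identifies the constant as the mean of [G]. *)
have EG : \int[P]_t G t = c.
  transitivity (\int[P]_t (\1_setT (xi i t) * G t)).
    by apply: eq_Rintegral => t _; rewrite indicT mul1r.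
  rewrite indP//; under eq_Rintegral do rewrite indicT.
  have PT : P setT = 1%E by exact: probability_setT.
  by rewrite Rintegral_cst// [X in fine X]PT mul1r mul1r.
have iG := all_moments_integrable aG.
have key : forall B : set R, measurable B ->
    (\int[P]_(t in xi i @^-1` B) (G t)%:E = \int[P]_(t in xi i @^-1` B) c%:E)%E.
  move=> B mB.
  have mxB : measurable (xi i @^-1` B).
    by rewrite -[_ @^-1` _]setTI; exact: mxi.
  have ic : P.-integrable setT (EFin \o cst c) by exact: finite_measure_integrable_cst.
  rewrite -[LHS]fineK; last by apply: integrable_fin_num => //; exact: integrableS iG.
  rewrite -[RHS]fineK; last by apply: integrable_fin_num => //; exact: integrableS ic.
  congr EFin; rewrite -[LHS]/(\int[P]_(t in xi i @^-1` B) G t).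
  rewrite -Rintegral_indicM//.
  under eq_Rintegral do rewrite indicE.
  have := indP B mB; under eq_Rintegral do rewrite indicE.
  under [in RHS]eq_Rintegral do rewrite indicE.
  move=> ->; rewrite -[RHS]/(\int[P]_(t in xi i @^-1` B) c).
  rewrite Rintegral_cst// mulrC; congr (_ * _).
  by rewrite -Rintegral_indic//; apply: eq_Rintegral => t _; rewrite indicE.
rewrite [RHS](bigD1 i)//= -/c.
transitivity (\int[P]_t (g i (xi i t) * G t)).
  by apply: eq_Rintegral => t _; rewrite (bigD1 i).
(* Both sides use the same variable [xi i]; only the weight changes, from [G] to its mean [c]. *)
rewrite (@transport _ _ _ P _ _ P (xi i) G (xi i) (cst c))//.
- by rewrite RintegralZr//; exact: all_moments_integrable.
- exact: finite_measure_integrable_cst.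
- by apply: all_moments_integrable; exact: all_momentsM.
- under eq_fun do rewrite mulrC EFinM.
  by apply: integrableZl => //; exact: all_moments_integrable.
Qed.

Lemma expectation_monomial (e : I -> nat) :
  \int[P]_t (\prod_i xi i t ^+ e i) = \prod_i \int[mu]_x (x ^+ e i * phi x).
Proof.
rewrite (@expectation_prod_partial (enum I) (fun i x => x ^+ e i)).
- by apply: eq_bigr => i _; rewrite moment_normal.
- exact: enum_uniq.
- by move=> i; exact: measurable_funX.
- move=> i; elim: (e i) => [|k IH].
    under eq_fun do rewrite expr0.
    by apply: (@all_moments_bounded _ _ _ _ _ 1) => // t; rewrite normr1.
  under eq_fun do rewrite exprS; apply: all_momentsM => //.
  exact: all_moments_normal.
- by move=> i; rewrite mem_enum.
Qed.

Lemma prod_seq_count (s : seq I) (v : I -> R) :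
  \prod_(i <- s) v i = \prod_i v i ^+ count_mem i s.
Proof.
elim: s => [|i s IH]; first by rewrite big_nil big1.
rewrite big_cons IH (bigD1 i)//= [RHS](bigD1 i)//= eqxx exprD expr1 mulrA.
congr (_ * _); apply: eq_bigr => j ji.
by rewrite eq_sym (negbTE ji).
Qed.

(** After factoring by independence only the factor at [i] differs, and there [moment_rec] applies.
    If [i] does not occur in [s], an odd first moment matches the zero coefficient. *)
Lemma gaussian_ibp_monomial (i : I) (s : seq I) :
  \int[P]_t (xi i t * \prod_(j <- s) xi j t) =
  (count_mem i s)%:R * \int[P]_t (\prod_(j <- rem i s) xi j t).
Proof.
have E r : \int[P]_t (\prod_(j <- r) xi j t) =
    \prod_j \int[mu]_x (x ^+ count_mem j r * phi x).
  rewrite -expectation_monomial; apply: eq_Rintegral => t _.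
  by rewrite (prod_seq_count r (fun j => xi j t)).
transitivity (\int[P]_t (\prod_(j <- i :: s) xi j t)).
  by apply: eq_Rintegral => t _; rewrite big_cons.
have ci : count_mem i (i :: s) = (count_mem i s).+1 by rewrite /= eqxx.
rewrite !E (bigD1 i)// [in RHS](bigD1 i)// mulrA ci moment_rec.
congr (_ * _).
  rewrite count_rem /= eqxx/=; have [_|/count_memPn ->] := boolP (i \in s).
    by rewrite subn1.
  by rewrite !mul0r.
apply: eq_bigr => j ji; apply: eq_Rintegral => x _; congr (_ ^+ _ * _).
have ij : (i == j) = false by rewrite eq_sym (negbTE ji).
by rewrite count_rem /= ij andbF subn0.
Qed.

End GaussianFamily.

(** * Linear forms and directional derivatives of their products *)

Section LinearForms.
Context {R : realType} {I : finType}.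
Implicit Types (u w v : I -> R) (s : seq I) (us : seq (I -> R)).

Definition dot u v := \sum_i u i * v i.

Lemma dot_delta i v : dot (fun j => (j == i)%:R) v = v i.
Proof.
rewrite /dot (bigD1 i)//= eqxx mul1r big1 ?addr0// => j /negbTE ->.
by rewrite mul0r.
Qed.

(* Derivatives in the direction [u] of the products of the coordinates in [s]
   and of the linear forms in [us]. *)
Fixpoint dmono u s v : R :=
  if s is j :: s' then u j * \prod_(i <- s') v i + v j * dmono u s' v else 0.

Fixpoint dforms u us v : R :=
  if us is w :: us' then
    dot u w * \prod_(z <- us') dot z v + dot w v * dforms u us' v
  else 0.

Lemma polyfun_dot u : polyfun (dot u).
Proof.
apply: polyfun_sum => i.
by apply: polyfunM; [exact: polyfun_cst|exact: polyfun_var].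
Qed.

Lemma polyfun_mono s : polyfun (fun v => \prod_(i <- s) v i).
Proof. by apply: polyfun_prod => i; exact: polyfun_var. Qed.

Lemma polyfun_forms us : polyfun (fun v => \prod_(z <- us) dot z v).
Proof. by apply: polyfun_prod => z; exact: polyfun_dot. Qed.

Lemma polyfun_dmono u s : polyfun (dmono u s).
Proof.
elim: s => [|j s IH] /=; first exact: polyfun_cst.
apply: polyfunD; apply: polyfunM => //.
- exact: polyfun_cst.
- exact: polyfun_mono.
- exact: polyfun_var.
Qed.

Lemma polyfun_dforms u us : polyfun (dforms u us).
Proof.
elim: us => [|w us IH] /=; first exact: polyfun_cst.
apply: polyfunD; apply: polyfunM => //.
- exact: polyfun_cst.
- exact: polyfun_forms.
- exact: polyfun_dot.
Qed.

(** The Leibniz rule grouped by variable instead of by position, the form in which integration by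
    parts for monomials applies. *)
Lemma dmonoE u s v :
  dmono u s v = \sum_i u i * ((count_mem i s)%:R * \prod_(j <- rem i s) v j).
Proof.
elim: s => [|j s IH] /=.
  by rewrite big1// => i _; rewrite mul0r mulr0.
rewrite IH (bigD1 j)//= [in RHS](bigD1 j)//= !eqxx/= mulrDr addrA; congr (_ + _).
  rewrite natrD mulrDl mul1r mulrDr; congr (_ + _).
  have [js|/count_memPn ->] := boolP (j \in s); last by rewrite !mul0r !mulr0.
  have -> : \prod_(i <- s) v i = v j * \prod_(i <- rem j s) v i.
    by rewrite (perm_big _ (perm_to_rem js)) big_cons.
  by move: (_%:R) => c; ring.
rewrite mulr_sumr; apply: eq_bigr => i ij.
have ji : (j == i) = false by rewrite eq_sym (negbTE ij).
by rewrite ji add0n big_cons; move: (_%:R) => c; ring.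
Qed.

End LinearForms.

(** * Gaussian expectations of polynomials: integration by parts, rotation invariance,
    definiteness *)

Section GaussianExpectation.
Context {R : realType} {dT : measure_display} {T : measurableType dT}.
Variables (P : probability T R) (I : finType) (xi : I -> T -> R).
Hypothesis hind : mutually_independent P xi.
Hypothesis hN : forall i, std_normal P (xi i).

Definition gexp (p : (I -> R) -> R) : R := \int[P]_t p (fun i => xi i t).

Lemma polyfun_integrable p : polyfun p ->
  P.-integrable setT (fun t => (p (fun i => xi i t))%:E).
Proof.
move=> [l lE].
have -> : (fun t => (p (fun i => xi i t))%:E) =
    (fun t => \sum_(m <- l) m.1%:E * (\prod_(i <- m.2) xi i t)%:E)%E.
  by apply/funext => t; rewrite lE -sumEFin; under eq_bigr do rewrite EFinM.
apply: integrable_sum => // m _; apply: integrableZl => //.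
apply: all_moments_integrable; apply: all_moments_prod => i.
exact: all_moments_normal.
Qed.

Lemma eq_gexp p q : p =1 q -> gexp p = gexp q.
Proof. by move=> pq; apply: eq_Rintegral => t _; rewrite pq. Qed.

Lemma gexpD p q : polyfun p -> polyfun q ->
  gexp (fun v => p v + q v) = gexp p + gexp q.
Proof. by move=> pp qp; rewrite /gexp RintegralD//; exact: polyfun_integrable. Qed.

Lemma gexpZ c p : polyfun p -> gexp (fun v => c * p v) = c * gexp p.
Proof. by move=> pp; rewrite /gexp RintegralZl//; exact: polyfun_integrable. Qed.

Lemma gexp_sum (S : Type) (r : seq S) (f : S -> (I -> R) -> R) :
  (forall s, polyfun (f s)) ->
  gexp (fun v => \sum_(s <- r) f s v) = \sum_(s <- r) gexp (f s).
Proof.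
move=> fp; elim: r => [|s r IH].
  rewrite big_nil -[RHS](mul0r (gexp (fun=> 0))) -gexpZ; last exact: polyfun_cst.
  by apply: eq_gexp => v; rewrite big_nil mulr0.
rewrite big_cons -IH -gexpD//; last exact: polyfun_sum.
by apply: eq_gexp => v; rewrite big_cons.
Qed.

Lemma le_gexp p q : polyfun p -> polyfun q -> (forall v, p v <= q v) ->
  gexp p <= gexp q.
Proof.
move=> pp qp pq; apply: le_Rintegral => //; exact: polyfun_integrable.
Qed.

Lemma gexp_ibp u s :
  gexp (fun v => dot u v * \prod_(j <- s) v j) = gexp (dmono u s).
Proof.
have pm r i : polyfun (fun v : I -> R => v i * \prod_(j <- r) v j).
  by apply: polyfunM; [exact: polyfun_var|exact: polyfun_mono].
transitivity (gexp (fun v => \sum_i u i * (v i * \prod_(j <- s) v j))).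
  by apply: eq_gexp => v; rewrite /dot mulr_suml; apply: eq_bigr => i _; rewrite mulrA.
rewrite gexp_sum => [|i]; last by apply: polyfunM => //; exact: polyfun_cst.
have pr i : polyfun (fun v : I -> R => (count_mem i s)%:R * \prod_(j <- rem i s) v j).
  by apply: polyfunM; [exact: polyfun_cst|exact: polyfun_mono].
rewrite (eq_gexp (dmonoE u s)) gexp_sum => [|i]; last first.
  by apply: polyfunM => //; exact: polyfun_cst.
apply: eq_bigr => i _; rewrite !gexpZ//; last exact: polyfun_mono.
by congr (_ * _); exact: gaussian_ibp_monomial.
Qed.

(** The coordinates [s] are there for the induction on [us]: expanding the head form in coordinates
    moves one factor from [us] to [s]. *)
Lemma gexp_ibp_mixed u us s :
  gexp (fun v => dot u v * (\prod_(z <- us) dot z v * \prod_(j <- s) v j)) =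
  gexp (fun v => dforms u us v * \prod_(j <- s) v j +
                 \prod_(z <- us) dot z v * dmono u s v).
Proof.
elim: us s => [|w us IH] s.
  transitivity (gexp (fun v => dot u v * \prod_(j <- s) v j)).
    by apply: eq_gexp => v; rewrite big_nil mul1r.
  by rewrite gexp_ibp; apply: eq_gexp => v; rewrite big_nil mul1r mul0r add0r.
transitivity (gexp (fun v => \sum_j w j * (dot u v *
    (\prod_(z <- us) dot z v * \prod_(k <- j :: s) v k)))).
  apply: eq_gexp => v; rewrite big_cons.
  set F := \prod_(z <- us) dot z v; set m := \prod_(j <- s) v j.
  transitivity (dot w v * (dot u v * (F * m))); first by ring.
  rewrite [dot w v]/dot mulr_suml.
  by apply: eq_bigr => j _; rewrite big_cons -/m; ring.
rewrite gexp_sum => [|j]; last first.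
  apply: polyfunM; first exact: polyfun_cst.
  apply: polyfunM; first exact: polyfun_dot.
  by apply: polyfunM; [exact: polyfun_forms|exact: polyfun_mono].
pose f j v := w j * (dforms u us v * \prod_(k <- j :: s) v k +
                     \prod_(z <- us) dot z v * dmono u (j :: s) v).
have pf j : polyfun (fun v => dforms u us v * \prod_(k <- j :: s) v k +
                     \prod_(z <- us) dot z v * dmono u (j :: s) v).
  apply: polyfunD; apply: polyfunM.
  - exact: polyfun_dforms.
  - exact: polyfun_mono.
  - exact: polyfun_forms.
  - exact: polyfun_dmono.
transitivity (\sum_j gexp (f j)).
  apply: eq_bigr => j _; rewrite /f !gexpZ ?IH//.
  apply: polyfunM; first exact: polyfun_dot.
  by apply: polyfunM; [exact: polyfun_forms|exact: polyfun_mono].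
rewrite -gexp_sum; last by move=> j; apply: polyfunM => //; exact: polyfun_cst.
apply: eq_gexp => v; rewrite /f /= big_cons.
set D := dforms u us v; set F := \prod_(z <- us) dot z v.
set m := \prod_(j <- s) v j; set d := dmono u s v.
(* The derivative of the moved coordinate [j] is [u j]; summed against [w j] it gives the term
   [dot u w] of [dforms]. *)
transitivity (dot w v * (D * m + F * d) + dot u w * (F * m)); last by ring.
rewrite /dot !mulr_suml -big_split/=.
by apply: eq_bigr => j _; rewrite big_cons -/m; ring.
Qed.

Lemma gexp_ibp_forms u us :
  gexp (fun v => dot u v * \prod_(z <- us) dot z v) = gexp (dforms u us).
Proof.
have := gexp_ibp_mixed u us [::].
under eq_gexp do rewrite big_nil mulr1.
by move=> ->; apply: eq_gexp => v; rewrite big_nil mulr1 mulr0 addr0.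
Qed.

(* Integration by parts expresses the expectation of a product of linear forms
   through their pairwise inner products only. *)
Lemma gexp_forms_isometry (J : Type) (a b : J -> I -> R) (s : seq J) :
  (forall j k, dot (a j) (a k) = dot (b j) (b k)) ->
  gexp (fun v => \prod_(j <- s) dot (a j) v) =
  gexp (fun v => \prod_(j <- s) dot (b j) v).
Proof.
move=> ab; move: {2}(size s) (leqnn (size s)) => n.
elim: n s => [|n IH] [|j s]//; rewrite ?[(size (_ :: _) <= _)%N]ltnS => sn;
  try by apply: eq_gexp => v; rewrite !big_nil.
(* Either [j] is paired with [k], which removes both factors, or [k] joins the undifferentiated
   factors [ws]. *)
have expand (c : J -> I -> R) ws k r :
    gexp (fun v => \prod_(i <- ws) dot (c i) v * dforms (c j) (map c (k :: r)) v) =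
    dot (c j) (c k) * gexp (fun v => \prod_(i <- ws ++ r) dot (c i) v) +
    gexp (fun v => \prod_(i <- k :: ws) dot (c i) v * dforms (c j) (map c r) v).
  have pc q : polyfun (fun v => \prod_(i <- q) dot (c i) v).
    by apply: polyfun_prod => i; exact: polyfun_dot.
  rewrite -gexpZ// -gexpD.
  - apply: eq_gexp => v; rewrite /= big_cat big_cons big_map/=; ring.
  - by apply: polyfunM => //; exact: polyfun_cst.
  - by apply: polyfunM => //; exact: polyfun_dforms.
(* The inner induction runs over the factors still to be differentiated; the size bound makes each
   product left by a pairing short enough for the outer hypothesis. *)
have claim r ws : (size r + size ws <= n)%N ->
    gexp (fun v => \prod_(i <- ws) dot (a i) v * dforms (a j) (map a r) v) =
    gexp (fun v => \prod_(i <- ws) dot (b i) v * dforms (b j) (map b r) v).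
  elim: r ws => [|k r IHr] ws h.
    by apply: eq_gexp => v /=; rewrite !mulr0.
  rewrite !expand ab IH; last by rewrite size_cat addnC ltnW.
  by rewrite IHr//= addnS.
have red (c : J -> I -> R) : gexp (fun v => \prod_(i <- j :: s) dot (c i) v) =
    gexp (fun v => \prod_(i <- [::]) dot (c i) v * dforms (c j) (map c s) v).
  transitivity (gexp (dforms (c j) (map c s))).
    rewrite -gexp_ibp_forms; apply: eq_gexp => v.
    by rewrite big_cons big_map.
  by apply: eq_gexp => v; rewrite big_nil mul1r.
by rewrite !red claim// addn0.
Qed.

(** The rows of [O] have the same inner products as the coordinate vectors, so each monomial keeps
    its expectation. *)
Lemma gexp_rotation (O : I -> I -> R) p : polyfun p ->
  (forall i j, dot (O i) (O j) = (i == j)%:R) ->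
  gexp (fun v => p (fun i => dot (O i) v)) = gexp p.
Proof.
move=> [l lE] OO.
rewrite (eq_gexp (q := fun v => \sum_(m <- l) m.1 * \prod_(i <- m.2) dot (O i) v));
  last by move=> v; rewrite lE.
rewrite [RHS](eq_gexp lE) !gexp_sum.
- apply: eq_bigr => m _; rewrite !gexpZ.
  + congr (_ * _); rewrite (gexp_forms_isometry (b := fun i j => (j == i)%:R)).
      by apply: eq_gexp => v; apply: eq_bigr => i _; rewrite dot_delta.
    by move=> i j; rewrite OO dot_delta.
  + exact: polyfun_mono.
  + by apply: polyfun_prod => i; exact: polyfun_dot.
- by move=> m; apply: polyfunM; [exact: polyfun_cst|exact: polyfun_mono].
- move=> m; apply: polyfunM; first exact: polyfun_cst.
  by apply: polyfun_prod => i; exact: polyfun_dot.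
Qed.

(** Each word splits into parameter letters and Gaussian letters, and the latter integrate to a
    constant. Hence the expected squared error is a polynomial in the matrix entries. *)
Lemma polyfun_gexp (J : finType) (p : (J + I -> R) -> R) : polyfun p ->
  polyfun (fun th : J -> R =>
    gexp (fun v => p (fun u => match u with inl j => th j | inr i => v i end))).
Proof.
move=> [l lE].
pose jn (th : J -> R) (v : I -> R) u := match u with inl j => th j | inr i => v i end.
have spl (s : seq (J + I)) : exists s1 s2, forall th v,
    \prod_(u <- s) jn th v u = \prod_(j <- s1) th j * \prod_(i <- s2) v i.
  elim: s => [|[j|i] s [s1 [s2 IH]]].
  - by exists [::], [::] => th v; rewrite !big_nil mulr1.
  - by exists (j :: s1), s2 => th v; rewrite !big_cons IH mulrA.
  - by exists s1, (i :: s2) => th v; rewrite !big_cons IH mulrCA.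
have pv th (s : seq (J + I)) : polyfun (fun v => \prod_(u <- s) jn th v u).
  by apply: polyfun_prod => -[j|i]; [exact: polyfun_cst|exact: polyfun_var].
apply: (@eq_polyfun _ _ (fun th => \sum_(m <- l) m.1 *
    gexp (fun v => \prod_(u <- m.2) jn th v u))).
  move=> th; rewrite [RHS](eq_gexp (fun v => lE (jn th v))) gexp_sum.
    by apply: eq_bigr => m _; rewrite gexpZ.
  by move=> m; apply: polyfunM => //; exact: polyfun_cst.
apply: polyfun_sum => m; apply: polyfunM; first exact: polyfun_cst.
have [s1 [s2 sE]] := spl m.2.
apply: (@eq_polyfun _ _ (fun th => (\prod_(j <- s1) th j) *
    gexp (fun v => \prod_(i <- s2) v i))).
  by move=> th; rewrite -gexpZ; [apply: eq_gexp => v; rewrite sE|exact: polyfun_mono].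
by apply: polyfunM; [exact: polyfun_mono|exact: polyfun_cst].
Qed.

Lemma normal_prob_itv_gt0 (a r : R) : 0 < r ->
  (0 < normal_prob 0 1 (`](a - r)%R, (a + r)%R[%classic : set R))%E.
Proof.
move=> r0; pose M := `|a| + r.
have M0 : 0 <= M by rewrite addr_ge0// ltW.
pose c := normal_pdf 0 1 M : R.
have c0 : 0 < c by rewrite /c std_normal_pdfE mulr_gt0 ?expR_gt0// normal_peak_gt0 ?oner_eq0.
apply: (@lt_le_trans _ _ (\int[lebesgue_measure]_(x in `](a - r)%R, (a + r)%R[) c%:E)%E).
  rewrite integral_cst//= lebesgue_measure_itv/= lte_fin ifT; last by lra.
  by rewrite -EFinB -EFinM lte_fin mulr_gt0//; lra.
apply: ge0_le_integral => //=.
- by move=> x _; rewrite lee_fin ltW.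
- by apply/measurable_EFinP; exact: measurable_funTS (@measurable_normal_pdf R 0 1).
move=> x; rewrite in_itv/= => /andP[x1 x2]; rewrite lee_fin /c !std_normal_pdfE.
rewrite ler_wpM2l ?normal_peak_ge0// ler_expR lerN2 ler_pM2r ?invr_gt0//.
rewrite -(real_normK (num_real x)) lerXn2r ?nnegrE//.
by rewrite /M ler_norml; have := ler_norm a; have := ler_norm (- a); rewrite normrN; lra.
Qed.

(** If [p v] were nonzero, [|p|] would exceed [|p v| / 2] on a small box around [v], and
    independence gives that box positive probability. *)
Lemma gexp_sqr_eq0 p : polyfun p -> gexp (fun v => p v ^+ 2) = 0 ->
  forall v, p v = 0.
Proof.
move=> pp p0 v; apply/eqP/negPn/negP => pv.
have e0 : 0 < `|p v| / 2 by rewrite divr_gt0 ?normr_gt0.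
have [r r0 near] := polyfun_near v pp e0.
pose B i : set R := `]v i - r, v i + r[%classic.
pose box := \bigcap_(i in [set: I]) (xi i @^-1` B i).
have mB i : measurable (B i) by exact: measurable_itv.
have mbox : measurable box.
  apply: fin_bigcap_measurable; first exact: finite_finset.
  by move=> i _; rewrite -[_ @^-1` _]setTI; exact: (hN i).1.
have Pbox : 0 < fine (P box).
  have Pb : (0 < P box)%E.
    rewrite /box hind//; apply: (big_ind (fun x => 0 < x)%E) => [||i _]; first exact: lte01.
      exact: mule_gt0.
    by rewrite (hN i).2//; exact: normal_prob_itv_gt0.
  by rewrite fine_gt0// Pb/= ltey_eq fin_num_measure.
have : gexp (fun v => p v ^+ 2) >= (`|p v| / 2) ^+ 2 * fine (P box).
  rewrite -Rintegral_indic// -RintegralZl//; last exact: integrable_indic.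
  apply: le_Rintegral => //.
  - have ibox : P.-integrable setT (EFin \o (\1_box : T -> R)) by exact: integrable_indic.
    have := integrableZl measurableT ((`|p v| / 2) ^+ 2) ibox.
    by apply: eq_integrable => // t _ /=; rewrite EFinM.
  - exact: (polyfun_integrable (polyfunX 2 pp)).
  move=> t _; rewrite indicE; have [tb|_] := boolP (t \in box); last first.
    by rewrite mulr0 sqr_ge0.
  rewrite mulr1 -[leRHS]real_normK ?num_real// lerXn2r ?nnegrE ?normr_ge0 ?(ltW e0)//.
  have : `|p (fun i => xi i t) - p v| < `|p v| / 2.
    apply: near => i; move/set_mem : tb => /(_ i Logic.I).
    by rewrite /B /= in_itv/= => /andP[? ?]; rewrite ltr_norml; lra.
  have := ler_normD (p (fun i => xi i t)) (p v - p (fun i => xi i t)).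
  by rewrite addrC subrK distrC; lra.
by rewrite p0 leNgt mulr_gt0// exprn_gt0.
Qed.

End GaussianExpectation.

(** * The two-layer network *)

Section Network.
Context {R : realType} {d n : nat}.
Implicit Types (A B U : 'M[R]_d) (x : 'I_n.+1 -> 'I_d -> R) (w : 'I_d -> R).

Definition token x j : 'cV[R]_d := \col_k x j k.

Definition gram x : 'M[R]_d :=
  n%:R^-1 *: \sum_(j | j != ord_max) token x j *m (token x j)^T.

(* The scalars [a] and [b] homogenise the error, which is [net 1 A 1 B]. *)
Definition net (a : R) A (b : R) B x w : R :=
  (\row_k w k *m (a%:M + gram x *m A) *m (b%:M + gram x *m B)
     *m token x ord_max) 0 0.

Lemma sum_ord_max m (F : 'I_m.+1 -> R) :
  \sum_i F i = \sum_i F (lift ord_max i) + F ord_max.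
Proof.
rewrite big_ord_recr/=; congr (_ + _); apply: eq_bigr => i _; congr F.
by apply: val_inj; rewrite /= /bump leqNgt ltn_ord.
Qed.

Lemma Pmat_mulE m (Z : 'M[R]_(d.+1, m)) i j :
  (Pmat R d *m Z) i j = (i == ord_max)%:R * Z ord_max j.
Proof.
rewrite mxE (bigD1 ord_max)//= big1 ?addr0 => [|k kmax].
  by rewrite mxE eqxx andbT.
by rewrite mxE (negbTE kmax) andbF mul0r.
Qed.

Lemma mul_MmatE m (Z : 'M[R]_(m, n.+1)) i j :
  (Z *m Mmat R n) i j = Z i j * (j != ord_max)%:R.
Proof.
rewrite mxE (bigD1 j)//= big1 ?addr0 => [|k kj].
  by rewrite mxE eqxx.
by rewrite mxE (negbTE kj) mulr0.
Qed.

Lemma Qmat_formE A (Z : 'M[R]_(d.+1, n.+1)) x i j :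
  (forall k l, Z (lift ord_max k) l = x l k) ->
  (Z^T *m Qmat A *m Z) i j = ((token x i)^T *m A *m token x j) 0 0.
Proof.
move=> Zx.
have ZQ q : (Z^T *m Qmat A) i (lift ord_max q) = ((token x i)^T *m A) 0 q.
  rewrite mxE sum_ord_max [X in _ + X](_ : _ = 0); last first.
    by rewrite [Qmat _ _ _]mxE unlift_none mulr0.
  rewrite addr0 mxE; apply: eq_bigr => p _.
  by rewrite mxE [Qmat _ _ _]mxE !liftK !mxE Zx.
have ZQ0 : (Z^T *m Qmat A) i ord_max = 0.
  rewrite mxE big1// => p _; rewrite [Qmat _ _ _]mxE unlift_none.
  by case: (unlift _ _) => [?|]; rewrite mulr0.
rewrite mxE sum_ord_max ZQ0 mul0r addr0 [RHS]mxE; apply: eq_bigr => q _.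
by rewrite ZQ Zx [token _ _ _ _]mxE.
Qed.

(** [Pmat] lets a layer write only in the label row, so both layers see the same tokens and the same
    Gram matrix. *)
Lemma step_token A (Z : 'M[R]_(d.+1, n.+1)) x :
  (forall k l, Z (lift ord_max k) l = x l k) ->
  forall k l, step A Z (lift ord_max k) l = x l k.
Proof.
move=> Zx k l; rewrite /step mxE Zx [X in _ + X](_ : _ = 0) ?addr0//.
rewrite mxE [X in _ * X](_ : _ = 0) ?mulr0// mxE big1// => p _.
by rewrite mul_MmatE Pmat_mulE eq_sym (negbTE (neq_lift _ _)) !mul0r.
Qed.

Lemma step_label A (Z : 'M[R]_(d.+1, n.+1)) x j :
  (forall k l, Z (lift ord_max k) l = x l k) ->
  step A Z ord_max j = Z ord_max j + n%:R^-1 * \sum_(i | i != ord_max)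
    Z ord_max i * ((token x i)^T *m A *m token x j) 0 0.
Proof.
move=> Zx; rewrite /step mxE; congr (_ + _); rewrite mxE; congr (_ * _).
rewrite mxE [RHS]big_mkcond/=; apply: eq_bigr => i _.
rewrite mul_MmatE Pmat_mulE eqxx mul1r (Qmat_formE _ _ _ Zx).
by case: ifP => _; rewrite ?mulr1 ?mulr0 ?mul0r.
Qed.

Lemma gram_form A x (u : 'rV[R]_d) (z : 'cV[R]_d) :
  n%:R^-1 * \sum_(i | i != ord_max)
    (u *m token x i) 0 0 * ((token x i)^T *m A *m z) 0 0 =
  (u *m gram x *m A *m z) 0 0.
Proof.
rewrite /gram -scalemxAr -!scalemxAl mxE; congr (_ * _).
rewrite mulmx_sumr !mulmx_suml summxE; apply: eq_bigr => i _.
set t := token x i.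
have -> : u *m (t *m t^T) *m A *m z = (u *m t) *m (t^T *m A *m z) by rewrite !mulmxA.
by rewrite [RHS]mxE big_ord1.
Qed.

(** After one layer the example labels are [w^T (1 + G A) x_i]. The query label starts at 0 and
    lacks the term [w^T x], which is exactly what the error adds back. *)
Lemma sq_errE A B x w : sq_err A B x w = net 1 A 1 B x w ^+ 2.
Proof.
pose rw : 'rV[R]_d := \row_k w k.
have Z0x k l : Z0mat x w (lift ord_max k) l = x l k by rewrite mxE liftK.
have wxE j : (rw *m token x j) 0 0 = \sum_(k < d) x j k * w k.
  by rewrite mxE; apply: eq_bigr => k _; rewrite !mxE mulrC.
have Z0y j : Z0mat x w ord_max j = (j != ord_max)%:R * (rw *m token x j) 0 0.
  rewrite mxE unlift_none wxE; case: unliftP => [b ->|->].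
    by rewrite eq_sym neq_lift mul1r.
  by rewrite eqxx mul0r.
have Z1x := step_token A Z0x.
have Z1y j : step A (Z0mat x w) ord_max j =
    (j != ord_max)%:R * (rw *m token x j) 0 0 + (rw *m gram x *m A *m token x j) 0 0.
  rewrite (step_label _ _ Z0x) Z0y -gram_form; congr (_ + _ * _).
  by apply: eq_bigr => i im; rewrite Z0y im mul1r.
rewrite /sq_err; congr (_ ^+ 2).
rewrite (step_label _ _ Z1x) Z1y eqxx mul0r add0r.
have -> : \sum_(i | i != ord_max) step A (Z0mat x w) ord_max i *
    ((token x i)^T *m B *m token x ord_max) 0 0 =
    \sum_(i | i != ord_max) ((rw + rw *m gram x *m A) *m token x i) 0 0 *
    ((token x i)^T *m B *m token x ord_max) 0 0.
  apply: eq_bigr => i im; congr (_ * _).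
  by rewrite Z1y im mul1r mulmxDl [RHS]mxE.
rewrite gram_form.
have -> : \sum_(k < d) w k * x ord_max k = (rw *m token x ord_max) 0 0.
  by rewrite wxE; apply: eq_bigr => k _; rewrite mulrC.
rewrite /net !mulmxDr !mulmxDl !mulmx1 !mulmxA !mxE -/rw; ring.
Qed.

Lemma net_rotation (a b : R) A B U x w : U^T *m U = 1%:M ->
  net a A b B (fun j k => \sum_l U k l * x j l) (fun k => \sum_l U k l * w l) =
  net a (U^T *m A *m U) b (U^T *m B *m U) x w.
Proof.
move=> UU.
have tokU j : token (fun j k => \sum_l U k l * x j l) j = U *m token x j.
  by apply/matrixP => k z; rewrite !mxE; apply: eq_bigr => l _; rewrite mxE.
have rowU : \row_k (\sum_l U k l * w l) = \row_k w k *m U^T.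
  by apply/matrixP => z k; rewrite !mxE; apply: eq_bigr => l _; rewrite !mxE mulrC.
have gramU : gram (fun j k => \sum_l U k l * x j l) = U *m gram x *m U^T.
  rewrite /gram -scalemxAr -scalemxAl; congr (_ *: _).
  rewrite mulmx_sumr mulmx_suml; apply: eq_bigr => j _.
  by rewrite tokU trmx_mul !mulmxA.
(* [U^T] is carried rightwards through the two factors, conjugating each matrix on the way, and
   cancels against the [U] of the query token. *)
have move_U c C : U^T *m (c%:M + U *m gram x *m U^T *m C) =
    (c%:M + gram x *m (U^T *m C *m U)) *m U^T.
  rewrite mulmxDr mulmxDl -scalar_mxC; congr (_ + _).
  by rewrite !mulmxA UU mul1mx -!mulmxA (mulmx1C UU) mulmx1.
rewrite /net tokU rowU gramU -(mulmxA (\row_k w k)) move_U !mulmxA.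
rewrite -(mulmxA _ U^T (b%:M + _)) move_U -!mulmxA.
by rewrite (mulmxA U^T U) UU mul1mx.
Qed.

Lemma net_scale (s r a b : R) A B x w :
  net (s * a) (s *: A) (r * b) (r *: B) x w = s * r * net a A b B x w.
Proof.
rewrite /net -!scalemxAr -!scale_scalar_mx -!scalerDr -!scalemxAr -!scalemxAl.
by rewrite !mxE mulrA (mulrC r).
Qed.

Lemma net_average (a b : R) A B B' x w :
  net a A b (2^-1 *: (B + B')) x w = 2^-1 * (net a A b B x w + net a A b B' x w).
Proof.
rewrite /net; have -> : b%:M + gram x *m (2^-1 *: (B + B')) =
    2^-1 *: ((b%:M + gram x *m B) + (b%:M + gram x *m B')).
  rewrite addrACA -mulmxDr -scalemxAr [RHS]scalerDr; congr (_ + _).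
  by rewrite -mulr2n -[X in _ *: X]scaler_nat scalerA mulVf ?scale1r ?pnatr_eq0.
by rewrite -scalemxAr -scalemxAl mulmxDr mulmxDl !mxE.
Qed.

End Network.

(** * Matrices with polynomial entries *)

Section PolynomialMatrices.
Context {R : realType} {K : finType}.

Definition polymx m n (M : (K -> R) -> 'M[R]_(m, n)) :=
  forall i j, polyfun (fun u => M u i j).

Lemma polymxM m n p (M : (K -> R) -> 'M[R]_(m, n)) (N : (K -> R) -> 'M[R]_(n, p)) :
  polymx M -> polymx N -> polymx (fun u => M u *m N u).
Proof.
move=> pM pN i j; apply: (@eq_polyfun _ _ (fun u => \sum_k M u i k * N u k j)).
  by move=> u; rewrite mxE.
by apply: polyfun_sum => k; exact: polyfunM.
Qed.

Lemma polymxD m n (M N : (K -> R) -> 'M[R]_(m, n)) :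
  polymx M -> polymx N -> polymx (fun u => M u + N u).
Proof.
move=> pM pN i j; apply: eq_polyfun (polyfunD (pM i j) (pN i j)) => u.
by rewrite mxE.
Qed.

Lemma polymx_scalar n (a : (K -> R) -> R) :
  polyfun a -> polymx (fun u => (a u)%:M : 'M[R]_n).
Proof.
move=> pa i j; apply: eq_polyfun (polyfunM pa (polyfun_cst K (i == j)%:R)) => u.
by rewrite mxE mulr_natr.
Qed.

(** All arguments depend on [u], which covers both fixed matrices with variable data and the case
    where the matrices are variables as well. *)
Lemma polyfun_net d n (a b : (K -> R) -> R) (A B : (K -> R) -> 'M[R]_d)
    (x : 'I_n.+1 -> 'I_d -> (K -> R) -> R) (w : 'I_d -> (K -> R) -> R) :
  polyfun a -> polyfun b -> polymx A -> polymx B ->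
  (forall j k, polyfun (x j k)) -> (forall k, polyfun (w k)) ->
  polyfun (fun u => net (a u) (A u) (b u) (B u) (fun j k => x j k u) (fun k => w k u)).
Proof.
move=> pa pb pA pB px pw.
have ptok j : polymx (fun u => token (fun j k => x j k u) j).
  by move=> k z; apply: eq_polyfun (px j k) => u; rewrite mxE.
have pgram : polymx (fun u => gram (fun j k => x j k u)).
  move=> k l; apply: (@eq_polyfun _ _ (fun u => n%:R^-1 *
    \sum_(j <- enum 'I_n.+1 | j != ord_max) x j k u * x j l u)).
    move=> u; rewrite mxE; congr (_ * _); rewrite summxE big_enum_cond/=.
    by apply: eq_bigr => j _; rewrite mxE big_ord1 !mxE.
  apply: polyfunM; first exact: polyfun_cst.
  apply: (@eq_polyfun _ _ (fun u => \sum_(j <- [seq j <- enum 'I_n.+1 | j != ord_max])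
    x j k u * x j l u)); first by move=> u; rewrite big_filter.
  by apply: polyfun_sum => j; exact: polyfunM.
have prow : polymx (fun u => \row_k w k u).
  by move=> i k; apply: eq_polyfun (pw k) => u; rewrite mxE.
have pI (c : (K -> R) -> R) (C : (K -> R) -> 'M[R]_d) : polyfun c -> polymx C ->
    polymx (fun u => (c u)%:M + gram (fun j k => x j k u) *m C u).
  by move=> pc pC; apply: polymxD; [exact: polymx_scalar|exact: polymxM].
apply: (polymxM (polymxM (polymxM prow (pI a A pa pA)) (pI b B pb pB)) (ptok ord_max)).
Qed.

End PolynomialMatrices.

(** * The expected squared error: polynomiality, homogeneity, convexity, orthogonal invariance *)

Section Risk.
Context {R : realType} {d n : nat} {dT : measure_display} {T : measurableType dT}.
Variable P : probability T R.
Notation I := (('I_n.+1 * 'I_d) + 'I_d)%type.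
Notation J := (bool * option ('I_d * 'I_d))%type.
Variable xi : I -> T -> R.
Hypothesis hind : mutually_independent P xi.
Hypothesis hN : forall i, std_normal P (xi i).
Implicit Types (A B U : 'M[R]_d) (v : I -> R) (th : J -> R).

Definition netv (a : R) A (b : R) B v : R :=
  net a A b B (fun j k => v (inl (j, k))) (fun k => v (inr k)).

Definition risk (a : R) A (b : R) B : R :=
  gexp P xi (fun v => netv a A b B v ^+ 2).

(** In [J] the boolean is the layer, [true] for the first; [None] indexes the scalar in front of the
    identity and [Some (i, j)] a matrix entry. *)
Definition pmx (th : J -> R) c : 'M[R]_d := \matrix_(i, j) th (c, Some (i, j)).

Definition prisk (th : J -> R) : R :=
  risk (th (true, None)) (pmx th true) (th (false, None)) (pmx th false).

Lemma polyfun_netv (a : R) A (b : R) B : polyfun (netv a A b B).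
Proof.
apply: (@polyfun_net _ _ _ _ (fun=> a) (fun=> b) (fun=> A) (fun=> B)
  (fun j k v => v (inl (j, k))) (fun k v => v (inr k))).
- exact: polyfun_cst.
- exact: polyfun_cst.
- by move=> i j; exact: polyfun_cst.
- by move=> i j; exact: polyfun_cst.
- by move=> j k; exact: polyfun_var.
- by move=> k; exact: polyfun_var.
Qed.

Lemma polyfun_prisk : polyfun prisk.
Proof.
pose f (u : J + I -> R) := net (u (inl (true, None)))
  (\matrix_(i, j) u (inl (true, Some (i, j)))) (u (inl (false, None)))
  (\matrix_(i, j) u (inl (false, Some (i, j))))
  (fun j k => u (inr (inl (j, k)))) (fun k => u (inr (inr k))).
have pf : polyfun f.
  apply: (@polyfun_net _ _ _ _ (fun u => u (inl (true, None)))
    (fun u => u (inl (false, None)))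
    (fun u => \matrix_(i, j) u (inl (true, Some (i, j))))
    (fun u => \matrix_(i, j) u (inl (false, Some (i, j))))
    (fun j k u => u (inr (inl (j, k)))) (fun k u => u (inr (inr k)))).
  - exact: polyfun_var.
  - exact: polyfun_var.
  - move=> i j; apply: eq_polyfun (polyfun_var (inl (true, Some (i, j)))) => u.
    by rewrite mxE.
  - move=> i j; apply: eq_polyfun (polyfun_var (inl (false, Some (i, j)))) => u.
    by rewrite mxE.
  - by move=> j k; exact: polyfun_var.
  - by move=> k; exact: polyfun_var.
exact: (polyfun_gexp hN (polyfunX 2 pf)).
Qed.

Lemma risk_ge0 (a : R) A (b : R) B : 0 <= risk a A b B.
Proof. by apply: Rintegral_ge0 => t _; rewrite sqr_ge0. Qed.

Lemma risk_scale (s r a b : R) A B :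
  risk (s * a) (s *: A) (r * b) (r *: B) = (s * r) ^+ 2 * risk a A b B.
Proof.
rewrite /risk -gexpZ//; last exact: (polyfunX 2 (polyfun_netv _ _ _ _)).
by apply: eq_gexp => v; rewrite /netv net_scale exprMn.
Qed.

(** Midpoint convexity: the error is affine in [B] and squaring is convex. *)
Lemma risk_average (a b : R) A B B' :
  risk a A b (2^-1 *: (B + B')) <= 2^-1 * (risk a A b B + risk a A b B').
Proof.
have pp C := polyfunX 2 (polyfun_netv a A b C).
rewrite /risk -gexpD// -gexpZ//; last by apply: polyfunD.
apply: le_gexp => //.
- by apply: polyfunM; [exact: polyfun_cst|apply: polyfunD].
- move=> v; rewrite /netv net_average; have := sqr_ge0 (netv a A b B v - netv a A b B' v).
  by rewrite /netv; nra.
Qed.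

Lemma risk_rotation (a b : R) A B U : U^T *m U = 1%:M ->
  risk a (U^T *m A *m U) b (U^T *m B *m U) = risk a A b B.
Proof.
move=> UU; have UU' := mulmx1C UU.
have Udot k l : \sum_i U k i * U l i = (k == l)%:R.
  have := congr1 (fun M : 'M[R]_d => M k l) UU'; rewrite !mxE => <-.
  by apply: eq_bigr => i _; rewrite mxE.
(* The block-diagonal matrix that applies [U] to each of the [n + 1] tokens and to [w]. *)
pose O (i : I) (i' : I) : R := match i, i' with
  | inl (j, k), inl (j', l) => (j == j')%:R * U k l
  | inr k, inr l => U k l
  | _, _ => 0 end.
have Ol j k v : dot (O (inl (j, k))) v = \sum_l U k l * v (inl (j, l)).
  rewrite /dot big_sumType/= [X in _ + X]big1 ?addr0 => [|l _]; last by rewrite mul0r.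
  transitivity (\sum_(p : 'I_n.+1 * 'I_d)
      (j == p.1)%:R * U k p.2 * v (inl (p.1, p.2))); first by apply: eq_bigr => -[].
  rewrite -(pair_bigA _ (fun j' l => (j == j')%:R * U k l * v (inl (j', l))))/=.
  rewrite (bigD1 j)//= [X in _ + X]big1 ?addr0 => [|j' jj'].
    by apply: eq_bigr => l _; rewrite eqxx mul1r.
  by rewrite big1// => l _; rewrite eq_sym (negbTE jj') !mul0r.
have Or k v : dot (O (inr k)) v = \sum_l U k l * v (inr l).
  by rewrite /dot big_sumType/= big1 ?add0r// => -[j l] _; rewrite mul0r.
rewrite -[RHS](gexp_rotation hind hN (O := O)) //.
- rewrite /risk; apply: eq_gexp => v; congr (_ ^+ 2).
  rewrite /netv -(net_rotation _ _ _ _ _ _ UU).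
  have -> : (fun j k => dot (O (inl (j, k))) v) =
      (fun j k => \sum_l U k l * v (inl (j, l))).
    by apply/funext => j; apply/funext => k; rewrite Ol.
  have -> // : (fun k => dot (O (inr k)) v) = (fun k => \sum_l U k l * v (inr l)).
  by apply/funext => k; rewrite Or.
- exact: (polyfunX 2 (polyfun_netv _ _ _ _)).
- move=> [[j k]|k] [[j' l]|l]; rewrite ?Ol ?Or/=.
  + under eq_bigr do rewrite mulrCA.
    rewrite -mulr_sumr Udot -natrM mulnb (eq_sym j' j).
    by congr (_%:R).
  + by rewrite big1// => i _; rewrite mulr0.
  + by rewrite big1// => i _; rewrite mulr0.
  + by rewrite Udot.
Qed.

End Risk.

(** * Positivity *)

Section BilinearForms.
Context {R : realType} {d : nat}.
Implicit Types (A B : 'M[R]_d) (Y Z : 'cV[R]_d) (W : 'rV[R]_d).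

Definition bil A Y Z : R := (Y^T *m A *m Z) 0 0.

Lemma bilDl A Y Y' Z : bil A (Y + Y') Z = bil A Y Z + bil A Y' Z.
Proof. by rewrite /bil linearD/= !mulmxDl mxE. Qed.

Lemma bilDr A Y Z Z' : bil A Y (Z + Z') = bil A Y Z + bil A Y Z'.
Proof. by rewrite /bil mulmxDr mxE. Qed.

Lemma bilZl A c Y Z : bil A (c *: Y) Z = c * bil A Y Z.
Proof. by rewrite /bil linearZ/= -!scalemxAl mxE. Qed.

Lemma bilZr A c Y Z : bil A Y (c *: Z) = c * bil A Y Z.
Proof. by rewrite /bil -scalemxAr mxE. Qed.

Lemma bil_delta A i j : bil A (delta_mx i 0) (delta_mx j 0) = A i j.
Proof. by rewrite /bil trmx_delta -rowE -colE !mxE. Qed.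

Lemma bil_eq0 A : (forall Y Z, bil A Y Z = 0) -> A = 0.
Proof. by move=> A0; apply/matrixP => i j; rewrite -bil_delta A0 mxE. Qed.

(** Polarization at sums of two basis vectors. *)
Lemma sym_quad_eq0 A : A^T = A -> (forall Y, bil A Y Y = 0) -> A = 0.
Proof.
move=> As A0; apply/matrixP => i j; rewrite mxE.
have := A0 (delta_mx i 0 + delta_mx j 0).
rewrite bilDl !bilDr !A0 !bil_delta add0r addr0.
have -> : A j i = A i j by rewrite -[in LHS]As mxE.
by lra.
Qed.

(* On the line [Y0 + t Y] the quadratic form of [A] has at most two zeros. *)
Lemma quad_mul_bil_eq0 A B : A^T = A ->
  (forall Y Z, bil A Y Y * bil B Y Z = 0) -> A = 0 \/ B = 0.
Proof.
move=> As AB; have [A0|] := pselect (forall Y, bil A Y Y = 0).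
  by left; exact: sym_quad_eq0.
move=> /existsNP[Y0 /eqP AY0]; right; apply: bil_eq0 => Y Z.
have BY0 : bil B Y0 Z = 0.
  by have /eqP := AB Y0 Z; rewrite mulf_eq0 (negbTE AY0) => /eqP.
have pencil t : (bil A Y0 Y0 + t * (bil A Y0 Y + bil A Y Y0) + t ^+ 2 * bil A Y Y)
    * (t * bil B Y Z) = 0.
  have := AB (Y0 + t *: Y) Z.
  rewrite !bilDl !bilDr !bilZl !bilZr BY0 add0r => <-; ring.
have [//|B0] := eqVneq (bil B Y Z) 0.
have quad t : t != 0 ->
    bil A Y0 Y0 + t * (bil A Y0 Y + bil A Y Y0) + t ^+ 2 * bil A Y Y = 0.
  by move=> t0; have /eqP := pencil t; rewrite !mulf_eq0 (negbTE t0) (negbTE B0) !orbF => /eqP.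
(* Vanishing at 1, 2 and -1 forces every coefficient of the quadratic to be zero, against [AY0] for
   the constant one. *)
have q1 := quad 1 (oner_neq0 _).
have q2 : bil A Y0 Y0 + 2 * (bil A Y0 Y + bil A Y Y0) + 2 ^+ 2 * bil A Y Y = 0.
  by apply: quad; rewrite pnatr_eq0.
have q3 : bil A Y0 Y0 + -1 * (bil A Y0 Y + bil A Y Y0) + (-1) ^+ 2 * bil A Y Y = 0.
  by apply: quad; rewrite oppr_eq0 oner_eq0.
by move/eqP : AY0; case; lra.
Qed.

(** A Gram matrix of rank one reduces the matrix products to scalars, leaving a quadratic polynomial
    in [g] whose coefficients can be read off separately. *)
Lemma net_rank1 (a b g : R) A B W Y Z :
  (W *m (a%:M + g *: (Y *m Y^T) *m A) *m (b%:M + g *: (Y *m Y^T) *m B) *m Z) 0 0 =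
  a * b * (W *m Z) 0 0 + g * ((W *m Y) 0 0 * (a * bil B Y Z + b * bil A Y Z))
  + g ^+ 2 * ((W *m Y) 0 0 * (bil A Y Y * bil B Y Z)).
Proof.
have -> : W *m (a%:M + g *: (Y *m Y^T) *m A) =
    a *: W + (g * (W *m Y) 0 0) *: (Y^T *m A).
  rewrite mulmxDr mul_mx_scalar; congr (_ + _).
  rewrite -scalemxAl -scalemxAr !mulmxA -(mulmxA _ _ A) [W *m Y in LHS]mx11_scalar.
  by rewrite mul_scalar_mx scalerA.
rewrite -mulmxA.
have -> : (b%:M + g *: (Y *m Y^T) *m B) *m Z = b *: Z + (g * bil B Y Z) *: Y.
  rewrite mulmxDl mul_scalar_mx; congr (_ + _).
  rewrite -!scalemxAl -!mulmxA (mulmxA Y^T) [Y^T *m B *m Z]mx11_scalar.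
  by rewrite mul_mx_scalar scalerA.
rewrite mulmxDl !mulmxDr -!scalemxAl -!scalemxAr !scalerA.
rewrite -[_ *m A *m Y]/(Y^T *m A *m Y).
have mxD (M N : 'M[R]_1) : (M + N) 0 0 = M 0 0 + N 0 0 by rewrite mxE.
have mxZ c (M : 'M[R]_1) : (c *: M) 0 0 = c * M 0 0 by rewrite mxE.
rewrite !(mxD, mxZ) /bil; ring.
Qed.

End BilinearForms.

(** * The risk vanishes only when one layer is zero *)

Section Positivity.
Context {R : realType} {d n : nat} {dT : measure_display} {T : measurableType dT}.
Variable P : probability T R.
Notation I := (('I_n.+1 * 'I_d) + 'I_d)%type.
Variable xi : I -> T -> R.
Hypothesis hd : (0 < d)%N.
Hypothesis hn : (0 < n)%N.
Hypothesis hind : mutually_independent P xi.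
Hypothesis hN : forall i, std_normal P (xi i).
Implicit Types (A B : 'M[R]_d).

(* A prompt whose only nonzero example is [t *: Y] has a Gram matrix of rank one. *)
Lemma netv_rank1 (a b t : R) A B (W : 'rV[R]_d) (Y Z : 'cV[R]_d) :
  exists v : I -> R, netv a A b B v =
    a * b * (W *m Z) 0 0 +
    n%:R^-1 * t ^+ 2 * ((W *m Y) 0 0 * (a * bil B Y Z + b * bil A Y Z)) +
    (n%:R^-1 * t ^+ 2) ^+ 2 * ((W *m Y) 0 0 * (bil A Y Y * bil B Y Z)).
Proof.
have o0 : (ord0 : 'I_n.+1) != ord_max by rewrite -val_eqE/= eq_sym -lt0n.
pose x (j : 'I_n.+1) k :=
  if j == ord0 then t * Y k 0 else if j == ord_max then Z k 0 else 0.
exists (fun i => match i with inl (j, k) => x j k | inr k => W 0 k end).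
rewrite -net_rank1 -[LHS]/(net a A b B x (fun k => W 0 k)) /net.
have tok0 (V : 'cV[R]_d) j : (forall k, x j k = V k 0) -> token x j = V.
  by move=> xV; apply/matrixP => k z; rewrite mxE xV (ord1 z).
have -> : token x ord_max = Z.
  by apply: tok0 => k; rewrite /x eq_sym (negbTE o0) eqxx.
have -> : \row_k W 0 k = W by apply/matrixP => z k; rewrite mxE (ord1 z).
have -> // : gram x = (n%:R^-1 * t ^+ 2) *: (Y *m Y^T).
rewrite /gram (bigD1 ord0)//= [X in _ + X]big1 ?addr0 => [|j /andP[jm j0]].
  have -> : token x ord0 = t *: Y by apply: tok0 => k; rewrite /x eqxx mxE.
  by rewrite linearZ/= -scalemxAl -scalemxAr !scalerA mulrA.
have -> : token x j = 0.
  by apply: tok0 => k; rewrite /x (negbTE j0) (negbTE jm) mxE.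
by rewrite mul0mx.
Qed.

(** All three coefficients in the scale of the rank-one Gram matrix vanish. The constant one gives
    [a = 0] or [b = 0]; if just one scalar vanishes, the linear coefficient kills the matrix of its
    layer, and if both do, the quadratic coefficient kills one of the matrices. *)
Lemma netv_eq0 (a b : R) A B : A^T = A -> (forall v : I -> R, netv a A b B v = 0) ->
  (a = 0 /\ A = 0) \/ (b = 0 /\ B = 0).
Proof.
move=> As F0.
have c0 : n%:R^-1 != 0 :> R by rewrite invr_eq0 pnatr_eq0 -lt0n.
set c : R := n%:R^-1 in c0.
have E t (W : 'rV[R]_d) (Y Z : 'cV[R]_d) : a * b * (W *m Z) 0 0 +
    c * t ^+ 2 * ((W *m Y) 0 0 * (a * bil B Y Z + b * bil A Y Z)) +
    (c * t ^+ 2) ^+ 2 * ((W *m Y) 0 0 * (bil A Y Y * bil B Y Z)) = 0.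
  by have [v vE] := netv_rank1 a b t A B W Y Z; rewrite /c -vE F0.
have ab0 : a * b = 0.
  pose i := Ordinal hd; have := E 0 (delta_mx 0 i) 0 (delta_mx i 0).
  by rewrite mul_delta_mx mxE expr0n !(mulr0, mul0r) expr0n !(mulr0, mul0r, addr0) mulr1.
(* The values [t = 1] and [t = 2] give two independent equations for the linear and quadratic
   terms. *)
have XV (W : 'rV[R]_d) (Y Z : 'cV[R]_d) : (W *m Y) 0 0 * (a * bil B Y Z + b * bil A Y Z) = 0 /\
    (W *m Y) 0 0 * (bil A Y Y * bil B Y Z) = 0.
  have := E 2 W Y Z; have := E 1 W Y Z; rewrite ab0 mul0r add0r.
  move: ((W *m Y) 0 0 * (a * bil B Y Z + b * bil A Y Z)) => X.
  move: ((W *m Y) 0 0 * (bil A Y Y * bil B Y Z)) => V h1 h2.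
  have e1 : c * X + c ^+ 2 * V = 0 by rewrite -[RHS]h1; ring.
  have e2 : 4 * (c * X) + 16 * (c ^+ 2 * V) = 0 by rewrite -[RHS]h2; ring.
  have cX : c * X = 0 by lra.
  have cV : c ^+ 2 * V = 0 by lra.
  split; first by move/eqP : cX; rewrite mulf_eq0 (negbTE c0) => /eqP.
  by move/eqP : cV; rewrite mulf_eq0 expf_eq0/= (negbTE c0) => /eqP.
have norm (Y : 'cV[R]_d) : (Y^T *m Y) 0 0 = 0 -> Y = 0.
  move=> Y0; apply/matrixP => k z; rewrite (ord1 z) mxE.
  have /psumr_eq0P : \sum_k Y k 0 ^+ 2 = 0.
    by rewrite -[RHS]Y0 mxE; apply: eq_bigr => l _; rewrite mxE.
  move=> /(_ (fun l _ => sqr_ge0 _) k isT) /eqP.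
  by rewrite expf_eq0/= => /eqP.
have bil0 C Z : bil C 0 Z = 0 by rewrite /bil trmx0 !mul0mx mxE.
(* With [W = Y^T] the common factor is the squared norm of [Y], which vanishes only at [Y = 0]. *)
have lin Y Z : a * bil B Y Z + b * bil A Y Z = 0.
  have [/eqP] := XV Y^T Y Z; rewrite mulf_eq0 => /orP[/eqP/norm -> _|/eqP //].
  by rewrite !bil0 !mulr0 addr0.
have quad Y Z : bil A Y Y * bil B Y Z = 0.
  have [_ /eqP] := XV Y^T Y Z; rewrite mulf_eq0 => /orP[/eqP/norm ->|/eqP //].
  by rewrite !bil0 mul0r.
move/eqP : ab0; rewrite mulf_eq0 => /orP[] /eqP z0.
  have [bz|b0] := eqVneq b 0.
    by have [A0|B0] := quad_mul_bil_eq0 As quad; [left|right].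
  left; split=> //; apply: bil_eq0 => Y Z; have /eqP := lin Y Z.
  by rewrite z0 mul0r add0r mulf_eq0 (negbTE b0) => /eqP.
have [az|a0] := eqVneq a 0.
  by have [A0|B0] := quad_mul_bil_eq0 As quad; [left|right].
right; split=> //; apply: bil_eq0 => Y Z; have /eqP := lin Y Z.
by rewrite z0 mul0r addr0 mulf_eq0 (negbTE a0) => /eqP.
Qed.

Lemma risk_eq0 (a b : R) A B : A^T = A -> risk P xi a A b B = 0 ->
  (a = 0 /\ A = 0) \/ (b = 0 /\ B = 0).
Proof.
move=> As r0; apply: netv_eq0 => //.
exact: (gexp_sqr_eq0 hind hN (polyfun_netv _ _ _ _) r0).
Qed.

End Positivity.

(** * Existence of minimizers *)

Section BihomogeneousMinimizer.
Context {R : realType} {d : nat}.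
Notation J := (bool * option ('I_d * 'I_d))%type.
Implicit Types (A B : 'M[R]_d) (th : J -> R).

Definition sqnorm c th : R := th (c, None) ^+ 2 + \sum_p th (c, Some p) ^+ 2.

Lemma le_sqnorm c x th : th (c, x) ^+ 2 <= sqnorm c th.
Proof.
have s0 : 0 <= \sum_p th (c, Some p) ^+ 2.
  by apply: sumr_ge0 => p _; exact: sqr_ge0.
rewrite /sqnorm; case: x => [p|]; last by rewrite lerDl.
apply: ler_wpDl; first exact: sqr_ge0.
by rewrite (bigD1 p)//= lerDl; apply: sumr_ge0 => q _; exact: sqr_ge0.
Qed.

Lemma polyfun_sqnorm c : polyfun (sqnorm c).
Proof.
apply: polyfunD; first by apply: polyfunX; exact: polyfun_var.
by apply: polyfun_sum => p; apply: polyfunX; exact: polyfun_var.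
Qed.

(** Symmetry of both matrices as polynomial equations, the form of constraint that [polyfun_argmin]
    accepts. *)
Definition sym_eqs : set ((J -> R) -> R) :=
  [set g | exists c i j, g = (fun th => th (c, Some (i, j)) - th (c, Some (j, i)))].

Lemma polyfun_sym_eqs g : sym_eqs g -> polyfun g.
Proof.
move=> [c [i [j ->]]].
by apply: polyfunB; exact: polyfun_var.
Qed.

Lemma sym_eqsP th : (forall g, sym_eqs g -> g th = 0) <->
  (forall c, (pmx th c)^T = pmx th c).
Proof.
split=> [h c|h g [c [i [j ->]]]].
  apply/matrixP => i j; rewrite !mxE; apply/eqP; rewrite -subr_eq0; apply/eqP.
  by apply: (h (fun th => th (c, Some (j, i)) - th (c, Some (i, j)))); exists c, j, i.
by have /matrixP /(_ j i) := h c; rewrite !mxE => ->; rewrite subrr.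
Qed.

Variable Phi : (J -> R) -> R.
Hypothesis polyfun_Phi : polyfun Phi.
Hypothesis Phi_ge0 : forall th, 0 <= Phi th.
Hypothesis Phi_scale : forall (s : bool -> R) th,
  Phi (fun j => s j.1 * th j) = (s true * s false) ^+ 2 * Phi th.
Hypothesis Phi_eq0 : forall th, (forall c, (pmx th c)^T = pmx th c) ->
  Phi th = 0 -> exists c, forall x, th (c, x) = 0.

(* On the product of the two unit spheres [Phi] has a positive minimum [m]; the
   general bound follows by homogeneity. *)
Lemma bihomogeneous_coercive : exists2 m, 0 < m &
  forall th, (forall c, (pmx th c)^T = pmx th c) -> (forall c, 0 < sqnorm c th) ->
  m * (sqnorm true th * sqnorm false th) <= Phi th.
Proof.
pose Z := [set g | sym_eqs g \/ exists c, g = (fun th => sqnorm c th - 1)].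
have pZ g : Z g -> polyfun g.
  move=> [|[c ->]]; first exact: polyfun_sym_eqs.
  by apply: polyfunB; [exact: polyfun_sqnorm|exact: polyfun_cst].
have KP th : (forall c, (pmx th c)^T = pmx th c) -> (forall c, sqnorm c th = 1) ->
    (forall i, `|th i| <= 1) /\ forall g, Z g -> g th = 0.
  move=> sth nth; split.
    move=> [c x]; have := le_sqnorm c x th; rewrite nth.
    by rewrite -[X in _ <= X](expr1n _ 2) -real_normK ?num_real// ler_pXn2r ?nnegrE.
  move=> g [|[c ->]]; first exact: (sym_eqsP th).2.
  by rewrite nth subrr.
(* Scalars 1 and zero matrices: a point showing that the product of spheres is nonempty. *)
pose th0 (j : J) : R := if j.2 is None then 1 else 0.
have [|th1 [_ th1Z] th1min] := polyfun_argmin (M := 1) (Z := Z) (v0 := th0) polyfun_Phi pZ.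
  apply: KP => c; first by apply/matrixP => i j; rewrite !mxE.
  by rewrite /sqnorm /th0/= expr1n big1 ?addr0// => p _; rewrite expr0n.
have s1 := (sym_eqsP th1).1 (fun g Zg => th1Z g (or_introl Zg)).
have n1 c : sqnorm c th1 = 1.
  apply/eqP; rewrite -subr_eq0; apply/eqP.
  by apply: (th1Z (fun th => sqnorm c th - 1)); right; exists c.
exists (Phi th1).
  rewrite lt_def Phi_ge0 andbT; apply/eqP => /(Phi_eq0 s1)[c c0].
  have := n1 c; rewrite /sqnorm c0 expr0n add0r big1 => [/eqP|p _].
    by rewrite eq_sym oner_eq0.
  by rewrite c0 expr0n.
move=> th sth nth.
pose s c := Num.sqrt (sqnorm c th).
have s0 c : s c != 0 by rewrite gt_eqF// sqrtr_gt0.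
have ss c : s c ^+ 2 = sqnorm c th by rewrite sqr_sqrtr// ltW.
pose th' (j : J) := (s j.1)^-1 * th j.
have -> : Phi th = sqnorm true th * sqnorm false th * Phi th'.
  rewrite -!ss -exprMn -Phi_scale; congr Phi; apply/funext => j.
  by rewrite /th' mulrA divff// mul1r.
rewrite mulrC ler_wpM2l ?mulr_ge0 ?(ltW (nth _))//.
apply: th1min; apply: KP => c.
  apply/matrixP => i j; have /matrixP/(_ i j) := sth c.
  by rewrite !mxE /th'/= => ->.
rewrite /sqnorm /th'/= exprMn; under eq_bigr do rewrite exprMn.
by rewrite -mulr_sumr -mulrDr exprVn ss mulVf// gt_eqF.
Qed.

(** The slice where both scalars are 1, that is, the actual network; on it both values of [sqnorm]
    are at least 1. *)
Definition join_params A B (j : J) : R :=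
  match j with
  | (_, None) => 1
  | (c, Some (i, k)) => if c then A i k else B i k
  end.

Lemma pmx_join A B c : pmx (join_params A B) c = if c then A else B.
Proof. by apply/matrixP => i j; rewrite mxE; case: c. Qed.

(** On the slice each squared norm is at most the product of the two, so coercivity bounds the
    sublevel set of [f0] and a minimizer exists. A second compactness argument, over the minimizers,
    maximizes the diagonal of [A]. *)
Lemma bihomogeneous_minimizer_exists : exists A B, [/\ A^T = A, B^T = B,
  forall A' B', A'^T = A' -> B'^T = B' -> Phi (join_params A B) <= Phi (join_params A' B') &
  forall A' B', A'^T = A' -> B'^T = B' -> Phi (join_params A' B') <= Phi (join_params A B) ->
    \sum_i A' i i ^+ 2 <= \sum_i A i i ^+ 2].
Proof.
have [m m0 mP] := bihomogeneous_coercive.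
set f0 := Phi (join_params 0 0).
have f00 : 0 <= f0 by exact: Phi_ge0.
(* A coordinate larger than [M] in absolute value would have square above [M ^ 2 >= M > f0 / m]. *)
pose M := f0 / m + 1.
have fm0 : 0 <= f0 / m by rewrite divr_ge0// ltW.
have M1 : 1 <= M by rewrite lerDr.
have sym_join A B : A^T = A -> B^T = B ->
    forall c, (pmx (join_params A B) c)^T = pmx (join_params A B) c.
  by move=> sA sB c; rewrite pmx_join; case: c.
have bounded A B : A^T = A -> B^T = B -> Phi (join_params A B) <= f0 ->
    forall j, `|join_params A B j| <= M.
  move=> sA sB r0 [c x]; set th := join_params A B.
  have N1 b : 1 <= sqnorm b th.
    by apply: le_trans (le_sqnorm b None th); rewrite /th /= expr1n.
  have Npos b : 0 < sqnorm b th by exact: lt_le_trans (N1 b).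
  have := mP th (sym_join A B sA sB) Npos => h.
  have {}h : sqnorm true th * sqnorm false th <= f0 / m.
    by rewrite ler_pdivlMr// mulrC (le_trans h).
  have xN : th (c, x) ^+ 2 <= sqnorm true th * sqnorm false th.
    apply: (le_trans (le_sqnorm c x th)).
    case: c; first exact: ler_peMr (ltW (Npos true)) (N1 false).
    exact: ler_peMl (ltW (Npos false)) (N1 true).
  rewrite leNgt; apply/negP => Mx.
  have : `|th (c, x)| ^+ 2 <= f0 / m by rewrite real_normK ?num_real// (le_trans xN).
  have : M <= M ^+ 2 by rewrite ler_eXnr.
  have : M ^+ 2 < `|th (c, x)| ^+ 2 by rewrite ltr_pXn2r ?nnegrE// (le_trans _ M1).
  by rewrite /M; lra.
pose Z2 := [set g | sym_eqs g \/ exists c, g = (fun th : J -> R => th (c, None) - 1)].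
have pZ2 g : Z2 g -> polyfun g.
  move=> [|[c ->]]; first exact: polyfun_sym_eqs.
  by apply: polyfunB; [exact: polyfun_var|exact: polyfun_cst].
have Z2P A B : A^T = A -> B^T = B -> forall g, Z2 g -> g (join_params A B) = 0.
  move=> sA sB g [|[c ->]]; last by rewrite /= subrr.
  by apply: (sym_eqsP _).2; exact: sym_join.
have Z2E th : (forall g, Z2 g -> g th = 0) ->
    [/\ (pmx th true)^T = pmx th true, (pmx th false)^T = pmx th false &
        th = join_params (pmx th true) (pmx th false)].
  move=> thZ; have sth := (sym_eqsP th).1 (fun g Zg => thZ g (or_introl Zg)).
  split; [exact: sth|exact: sth|]; apply/funext => -[c [[i j]|]] /=.
    by case: c; rewrite mxE.
  apply/eqP; rewrite -subr_eq0; apply/eqP.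
  by apply: (thZ (fun th => th (c, None) - 1)); right; exists c.
have t0 : (0 : 'M[R]_d)^T = 0 by rewrite trmx0.
have [|th2 [_ th2Z] th2min] := polyfun_argmin (M := M) (Z := Z2)
    (v0 := join_params 0 0) polyfun_Phi pZ2.
  by split; [exact: bounded|exact: Z2P].
have [s2 s2' th2E] := Z2E _ th2Z.
have th2f0 : Phi th2 <= f0.
  apply: th2min.
  by split; [exact: bounded|exact: Z2P].
have gmin A B : A^T = A -> B^T = B -> Phi th2 <= Phi (join_params A B).
  move=> sA sB; have [rf|/ltW fr] := leP (Phi (join_params A B)) f0.
    by apply: th2min; split; [exact: bounded|exact: Z2P].
  exact: le_trans fr.
(* The minimizers are cut out by one more polynomial equation and lie in the same box. *)
pose Z3 := [set g | Z2 g \/ g = (fun th => Phi th - Phi th2)].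
have pZ3 g : Z3 g -> polyfun g.
  move=> [|->]; first exact: pZ2.
  by apply: polyfunB; [exact: polyfun_Phi|exact: polyfun_cst].
pose h (th : J -> R) := - \sum_i th (true, Some (i, i)) ^+ 2.
have ph : polyfun h.
  apply: polyfunN; apply: polyfun_sum => i; apply: polyfunX; exact: polyfun_var.
have K3 A B : A^T = A -> B^T = B -> Phi (join_params A B) <= Phi th2 ->
    (forall j, `|join_params A B j| <= M) /\
    forall g, Z3 g -> g (join_params A B) = 0.
  move=> sA sB r2; split; first by apply: bounded => //; exact: le_trans th2f0.
  move=> g [|->]; first exact: Z2P.
  by apply/eqP; rewrite subr_eq0 eq_le r2 gmin.
have [|th3 [_ th3Z] th3max] := polyfun_argmin (M := M) (Z := Z3)
    (v0 := th2) ph pZ3.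
  rewrite th2E; apply: K3 => //.
  by rewrite -th2E.
have [s3 s3' th3E] := Z2E _ (fun g Zg => th3Z g (or_introl Zg)).
have r3 : Phi (join_params (pmx th3 true) (pmx th3 false)) = Phi th2.
  rewrite -th3E; apply/eqP; rewrite -subr_eq0; apply/eqP.
  by apply: (th3Z (fun th => Phi th - Phi th2)); right.
exists (pmx th3 true), (pmx th3 false); split => //; rewrite r3//.
move=> A B sA sB rAB; have := th3max _ (K3 A B sA sB rAB).
rewrite /h lerN2 /=; congr (_ <= _).
by apply: eq_bigr => i _; rewrite mxE.
Qed.

End BihomogeneousMinimizer.

(** * Diagonal minimizers *)

Section Jacobi.
Context {R : realType}.

(* The half-angle formulas for the rotation diagonalising
   [[a, b], [b, e]]; its eigenvalues are [(a + e +- rho) / 2]. *)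
Lemma jacobi_coefficients (a b e : R) : b != 0 -> exists c s : R,
  c ^+ 2 + s ^+ 2 = 1 /\
  a ^+ 2 + e ^+ 2 < (c ^+ 2 * a + 2 * (c * s) * b + s ^+ 2 * e) ^+ 2 +
                    (s ^+ 2 * a - 2 * (c * s) * b + c ^+ 2 * e) ^+ 2.
Proof.
move=> b0; pose r2 := (a - e) ^+ 2 + (2 * b) ^+ 2.
have b2 : 0 < b ^+ 2 by rewrite exprn_even_gt0.
have r20 : 0 < r2 by rewrite /r2 exprMn; have := sqr_ge0 (a - e); nra.
pose rho := Num.sqrt r2.
have rho0 : 0 < rho by rewrite sqrtr_gt0.
have rhoE : rho ^+ 2 = r2 by rewrite sqr_sqrtr// ltW.
have rhon : rho != 0 by rewrite gt_eqF.
(* Cosine and sine of the double angle. Since [S] is nonzero, [1 + C > 0], so the half-angle cosine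
   [c] can be divided by. *)
pose C := (a - e) / rho; pose S := 2 * b / rho.
have aeE : a - e = C * rho by rewrite /C divfK.
have bE : 2 * b = S * rho by rewrite /S divfK.
have CS : C ^+ 2 + S ^+ 2 = 1.
  by rewrite /C /S !exprMn -mulrDl exprVn rhoE -exprMn -/r2 divff// gt_eqF.
have S0 : 0 < S ^+ 2 by rewrite exprn_even_gt0//= /S !mulf_neq0 ?invr_eq0// pnatr_eq0.
clearbody C S; have C1 : 0 < 1 + C by nra.
pose c := Num.sqrt ((1 + C) / 2).
have c0 : 0 < c by rewrite sqrtr_gt0 divr_gt0.
have cn : c != 0 by rewrite gt_eqF.
have cc : c ^+ 2 = (1 + C) / 2 by rewrite sqr_sqrtr// ltW// divr_gt0.
pose s := S / (2 * c).
have cs : 2 * (c * s) = S by rewrite /s; field.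
have ss : s ^+ 2 = (1 - C) / 2.
  apply: (@mulfI _ (c ^+ 2)); first by rewrite expf_neq0.
  have : (2 * (c * s)) ^+ 2 = S ^+ 2 by rewrite cs.
  by rewrite !exprMn cc; lra.
exists c, s; split; first by rewrite cc ss; lra.
rewrite cs cc ss.
have -> : (1 + C) / 2 * a + S * b + (1 - C) / 2 * e = (a + e + rho) / 2.
  have : C * (a - e) + S * (2 * b) = rho.
    by rewrite aeE bE !mulrA -!expr2 -mulrDl CS mul1r.
  by lra.
have -> : (1 - C) / 2 * a - S * b + (1 + C) / 2 * e = (a + e - rho) / 2.
  have : C * (a - e) + S * (2 * b) = rho.
    by rewrite aeE bE !mulrA -!expr2 -mulrDl CS mul1r.
  by lra.
(* The squares of the two eigenvalues add up to [a ^ 2 + e ^ 2 + 2 b ^ 2], and [b] is nonzero. *)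
have : rho ^+ 2 = (a - e) ^+ 2 + 4 * b ^+ 2 by rewrite rhoE /r2; ring.
by nra.
Qed.

Lemma jacobi_step d (A : 'M[R]_d) (k l : 'I_d) : A^T = A -> k != l ->
  A k l != 0 -> exists2 U : 'M[R]_d, U^T *m U = 1%:M &
  \sum_i A i i ^+ 2 < \sum_i (U^T *m A *m U) i i ^+ 2.
Proof.
move=> sA kl Akl; have [c [s [cs1 incr]]] := jacobi_coefficients (A k k) (A l l) Akl.
have lk : (l == k) = false by rewrite eq_sym (negbTE kl).
pose delta (i : 'I_d) (j : 'I_d) : R := (j == i)%:R.
(* The columns of [U]. Its block in the plane of [k] and [l] is a reflection, so orthogonal; the
   other basis vectors are fixed, and so are the other diagonal entries of [A]. *)
pose u (i : 'I_d) (j : 'I_d) : R :=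
  if i == k then c * delta k j + s * delta l j
  else if i == l then s * delta k j - c * delta l j else delta i j.
have du i v : dot (u i) v =
    if i == k then c * v k + s * v l else if i == l then s * v k - c * v l else v i.
  rewrite /u; case: ifP => _.
    rewrite -(dot_delta k v) -(dot_delta l v) /dot !mulr_sumr -big_split/=.
    by apply: eq_bigr => j _; rewrite mulrDl !mulrA.
  case: ifP => _; last exact: dot_delta.
  rewrite -(dot_delta k v) -(dot_delta l v) /dot !mulr_sumr -sumrB.
  by apply: eq_bigr => j _; rewrite mulrBl !mulrA.
pose U : 'M[R]_d := \matrix_(i, j) u j i.
exists U.
  apply/matrixP => i j; rewrite !mxE.
  transitivity (dot (u i) (u j)); first by apply: eq_bigr => p _; rewrite !mxE.
  rewrite du /u /delta !eqxx lk (negbTE kl).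
  have [ik|ik] := eqVneq i k; have [jk|jk] := eqVneq j k; rewrite ?ik ?jk ?eqxx.
  - by rewrite -[RHS]cs1 /=; ring.
  - have [jl|jl] := eqVneq j l; rewrite ?jl ?eqxx ?lk ?(eq_sym k j) ?(eq_sym l j).
      by rewrite ?(negbTE kl) /=; ring.
    by rewrite ?(negbTE jk) ?(negbTE jl) /=; ring.
  - have [il|il] := eqVneq i l; rewrite ?il ?eqxx ?lk ?(negbTE kl) /=; first by ring.
    by rewrite ?(eq_sym k i) ?(eq_sym l i) ?(negbTE ik) ?(negbTE il) /=; ring.
  - have [il|il] := eqVneq i l; have [jl|jl] := eqVneq j l; rewrite ?il ?jl ?eqxx.
    + by rewrite ?lk ?(negbTE kl) -[RHS]cs1 /=; ring.
    + rewrite ?(eq_sym k j) ?(eq_sym l j) ?(negbTE jk) ?(negbTE jl) /=; by ring.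
    + by rewrite ?(negbTE ik) ?(negbTE il) /=; ring.
    + by rewrite (eq_sym i j).
have UAU i : (U^T *m A *m U) i i = dot (u i) (fun q => dot (u i) (fun p => A p q)).
  rewrite mxE; apply: eq_bigr => q _; rewrite !mxE mulrC; congr (_ * _).
  by apply: eq_bigr => p _; rewrite !mxE.
have Alk : A l k = A k l by rewrite -[in LHS]sA mxE.
rewrite (bigD1 k)//= (bigD1 l) ?lk//= [ltRHS](bigD1 k)//= [X in _ < _ + X](bigD1 l) ?lk//=.
rewrite !addrA; apply: ltr_leD.
  rewrite !UAU !du !eqxx lk Alk; apply: (lt_le_trans incr).
  by rewrite le_eqVlt; apply/predU1P; left; congr (_ ^+ 2 + _ ^+ 2); ring.
apply: ler_sum => i /andP[ik il].
by rewrite UAU !du (negbTE ik) (negbTE il).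
Qed.

End Jacobi.

(** * Averaging over sign changes *)

Section SignFlip.
Context {R : realType} {d n : nat} {dT : measure_display} {T : measurableType dT}.
Variable P : probability T R.
Notation I := (('I_n.+1 * 'I_d) + 'I_d)%type.
Variable xi : I -> T -> R.
Hypothesis hind : mutually_independent P xi.
Hypothesis hN : forall i, std_normal P (xi i).
Implicit Types (A B : 'M[R]_d).
Notation risk := (risk P xi).

Definition flip (k : 'I_d) : 'M[R]_d := \matrix_(i, j) ((i == j)%:R * (-1) ^+ (i == k)).

Lemma flip_formE k B i j :
  ((flip k)^T *m B *m flip k) i j = (-1) ^+ (i == k) * B i j * (-1) ^+ (j == k).
Proof.
rewrite mxE (bigD1 j)//= big1 ?addr0 => [|q qj]; last first.
  by rewrite [flip _ _ _]mxE (negbTE qj) mul0r mulr0.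
rewrite mxE (bigD1 i)//= big1 ?addr0 => [|p pi]; last first.
  by rewrite !mxE (negbTE pi) !mul0r.
by rewrite !mxE !eqxx !mul1r.
Qed.

Lemma flip_orthogonal k : (flip k)^T *m flip k = 1%:M.
Proof.
apply/matrixP => i j; rewrite -[(flip k)^T]mulmx1 flip_formE !mxE.
have [->|ij] := eqVneq i j; last by rewrite mulr0 mul0r.
by rewrite mulr1 -expr2 sqrr_sign.
Qed.

(* The risk is convex in the second matrix and, when [A] is diagonal, invariant
   under the sign changes of [B]; averaging over them kills the rest of [B]. *)
Lemma risk_diagonalize A B (r : seq 'I_d) : is_diag_mx A ->
  exists B', risk 1 A 1 B' <= risk 1 A 1 B /\
    forall i j, i != j -> i \in r -> B' i j = 0.
Proof.
move=> /is_diag_mxP dA; elim: r => [|k r [B1 [B1le B1r]]].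
  by exists B; split => // i j _; rewrite in_nil.
pose B2 := (flip k)^T *m B1 *m flip k.
(* The average clears row [k] off the diagonal. Conjugation by [flip k] only changes signs, so rows
   cleared earlier stay cleared. *)
exists (2^-1 *: (B1 + B2)); split.
  have fA : (flip k)^T *m A *m flip k = A.
    apply/matrixP => i j; rewrite flip_formE.
    have [->|ij] := eqVneq i j; last by rewrite dA// mulr0 mul0r.
    by rewrite mulrAC -expr2 sqrr_sign mul1r.
  have := risk_average hN 1 1 A B1 B2.
  have -> : risk 1 A 1 B2 = risk 1 A 1 B1.
    by rewrite -{1}fA (risk_rotation hind hN)//; exact: flip_orthogonal.
  move=> h; apply: le_trans B1le; apply: (le_trans h).
  by rewrite -mulr2n -[X in _ * X]mulr_natl mulrA mulVf ?mul1r// pnatr_eq0.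
move=> i j ij; rewrite inE mxE [X in _ * X]mxE flip_formE.
have [ik|ik] := eqVneq i k; last first.
  by move=> /= ir; rewrite B1r// mulr0 mul0r addr0 mulr0.
move=> _; have -> : (j == k) = false by rewrite -ik eq_sym (negbTE ij).
by rewrite expr1 expr0; lra.
Qed.

End SignFlip.

Theorem theorem2 (R : realType) (d n : nat) (hd : (0 < d)%N) (hn : (0 < n)%N)
  (dT : measure_display) (T : measurableType dT) (P : probability T R)
  (X : 'I_n.+1 -> 'I_d -> T -> R) (W : 'I_d -> T -> R)
  (hind : mutually_independent P
            (fun u : ('I_n.+1 * 'I_d) + 'I_d =>
               match u with inl (j, k) => X j k | inr k => W k end))
  (hX : forall j k, std_normal P (X j k))
  (hW : forall k, std_normal P (W k)) :
  exists A0 A1 : 'M[R]_d,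
    is_diag_mx A0 /\ is_diag_mx A1 /\
    forall B0 B1 : 'M[R]_d, B0^T = B0 -> B1^T = B1 ->
      (ferr P X W A0 A1 <= ferr P X W B0 B1)%E.
Proof.
pose xi (u : ('I_n.+1 * 'I_d) + 'I_d) :=
  match u with inl (j, k) => X j k | inr k => W k end.
have hN u : std_normal P (xi u) by case: u => [[j k]|k]; [exact: hX|exact: hW].
(* The integrand is a polynomial in the Gaussian variables, so the extended-real integral is
   finite. *)
have ferrE A B : ferr P X W A B = (risk P xi 1 A 1 B)%:E.
  rewrite /ferr /risk /gexp /Rintegral fineK; last first.
    apply: integrable_fin_num => //.
    exact: (polyfun_integrable hN (polyfunX 2 (polyfun_netv _ _ _ _))).
  by apply: eq_integral => t _; rewrite sq_errE.
pose J := (bool * option ('I_d * 'I_d))%type.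
have scale (c : bool -> R) (th : J -> R) : prisk P xi (fun j => c j.1 * th j) =
    (c true * c false) ^+ 2 * prisk P xi th.
  have pE b : pmx (fun j => c j.1 * th j) b = c b *: pmx th b.
    by apply/matrixP => i j; rewrite !mxE.
  by rewrite /prisk !pE; exact: (risk_scale hN).
have nondeg (th : J -> R) : (forall c, (pmx th c)^T = pmx th c) ->
    prisk P xi th = 0 -> exists c, forall x, th (c, x) = 0.
  move=> sth /(risk_eq0 hd hn hind hN (sth true)) h.
  have ext c : th (c, None) = 0 -> pmx th c = 0 -> forall x, th (c, x) = 0.
    move=> t0 p0 [[i j]|]//; have /matrixP/(_ i j) := p0; rewrite !mxE; exact.
  by case: h => -[t0 p0]; [exists true|exists false]; exact: ext.
have [A [B [sA sB minAB maxA]]] := bihomogeneous_minimizer_exists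
  (polyfun_prisk hN) (fun th => risk_ge0 P xi _ _ _ _) scale nondeg.
have joinE A' B' : prisk P xi (join_params A' B') = risk P xi 1 A' 1 B'.
  by rewrite /prisk !pmx_join.
have dA : is_diag_mx A.
  apply/is_diag_mxP => k l kl; apply/eqP/negPn/negP => Akl.
  have [U UU] := jacobi_step sA kl Akl; rewrite ltNge => /negP; apply.
  have sym C : C^T = C -> (U^T *m C *m U)^T = U^T *m C *m U.
    by move=> sC; rewrite !trmx_mul trmxK sC mulmxA.
  (* The conjugated pair has the same risk, so a larger diagonal would contradict the choice of
     [A]. *)
  apply: (maxA _ (U^T *m B *m U) (sym _ sA) (sym _ sB)).
  by rewrite !joinE risk_rotation.
have [B' [B'le B'diag]] := risk_diagonalize hind hN B (enum 'I_d) dA.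
exists A, B'; split; first exact: dA.
split.
  by apply/is_diag_mxP => i j ij; apply: B'diag => //; rewrite mem_enum.
move=> B0 B1 sB0 sB1; rewrite !ferrE lee_fin; apply: (le_trans B'le).
have := minAB _ _ sB0 sB1; rewrite !joinE; exact.
Qed.
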